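(* Let $d\ge1$, let $a(t,x,\xi)$ be an admissible symbol (as defined in the context) with propagator $U(t,s)$, and write $U(t)=U(t,0)$. Assume that there are $0<\theta<1$ and a constant $C$ such that for all $u_0\in L^2(\mathbf{R}^d)$ the function $u(t)=U(t)u_0$ satisfies $$\|u\|_{L^{\frac{2(d+2)}{d}}_{t,x}([-1,1]\times\mathbf{R}^d)}\le C\Bigl(\sup_{0<\lambda\le1,\ |t|\le1,\ (x_0,\xi_0)\in T^*\mathbf{R}^d}\bigl|\langle S_\lambda\psi_{x_0,\xi_0},u(t)\rangle_{L^2(\mathbf{R}^d)}\bigr|\Bigr)^{\theta}\|u_0\|_{L^2(\mathbf{R}^d)}^{1-\theta}.$$ Let $u_n=U(t)f_n$ be a sequence of linear solutions with initial data $u_n(0)=f_n\in L^2(\mathbf{R}^d)$ such that $\|f_n\|_{L^2(\mathbf{R}^d)}\le A<\infty$ and $\|u_n\|_{L^{\frac{2(d+2)}{d}}_{t,x}([-1,1]\times\mathbf{R}^d)}\ge\varepsilon>0$ for all $n$. Then, after passing to a subsequence, there exist parameters $$\{(\lambda_n,t_n,x_n,\xi_n)\}_n\subset(0,1]\times[-1,1]\times\mathbf{R}^d_x\times\mathbf{R}^d_\xi$$ and a function $0\ne\phi\in L^2(\mathbf{R}^d)$ such that $$\pi(x_n,\xi_n)^{-1}S_{\lambda_n}^{-1}u_n(t_n)\rightharpoonup\phi\ \text{ weakly in } L^2(\mathbf{R}^d),\qquad \|\phi\|_{L^2}\ge c\,\varepsilon\Bigl(\frac{\varepsilon}{A}\Bigr)^{\frac{1-\theta}{\theta}},$$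 where $c>0$ is independent of $A$, $\varepsilon$ and the sequence $(f_n)$. Further, $$\|f_n\|_{L^2}^2-\|f_n-U(t_n)^{-1}S_{\lambda_n}\pi(x_n,\xi_n)\phi\|_{L^2}^2-\|U(t_n)^{-1}S_{\lambda_n}\pi(x_n,\xi_n)\phi\|_{L^2}^2\to0.$$
   Context: Admissible symbols: real-valued functions $a(t,x,\xi)$, measurable in $t$ and smooth in $(x,\xi)$, such that $|\partial_x^\alpha\partial_\xi^\beta a|\le c_{\alpha\beta}$ for all $|\alpha|+|\beta|\ge2$ (with fixed constants $c_{\alpha\beta}$), and such that $\bigl||\det a_{\xi\xi}|-1\bigr|+\bigl|\|a_{\xi\xi}\|-1\bigr|\le\varepsilon_0$ everywhere, where $0<\varepsilon_0<1$ is a fixed small constant and $\|\cdot\|$ is the operator norm of matrices. $D_t=-i\partial_t$, $D=-i\partial_x$, and $a^w(t,x,D)$ is the Weyl quantization of $a(t,\cdot,\cdot)$. The propagator $U(t,s)$ of $a$ is the unitary operator on $L^2(\mathbf{R}^d)$ such that $u(t)=U(t,s)u_s$ solves $(D_t+a^w(t,x,D))u=0$, $u(s,\cdot)=u_s$. $T^*\mathbf{R}^d=\mathbf{R}^d_x\times\mathbf{R}^d_\xi$. $\pi(x_0,\xi_0)f(x)=e^{i\langle x-x_0,\xi_0\rangle}f(x-x_0)$; $\psi(x)=c_de^{-|x|^2/2}$ with $c_d=2^{-d/2}\pi^{-3d/4}$; $\psi_{x_0,\xi_0}=\pi(x_0,\xi_0)\psi$; $S_\lambda f(x)=\lambda^{-d/2}f(\lambda^{-1}x)$.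 *)

(* Defs.v *)
From HB Require Import structures.
From mathcomp Require Import all_boot all_order all_algebra.
From mathcomp Require Import complex.
From mathcomp Require Import all_classical all_reals all_analysis.
Set Implicit Arguments. Unset Strict Implicit. Unset Printing Implicit Defensive.
Import Order.TTheory GRing.Theory Num.Theory.
Import numFieldNormedType.Exports Normc.
Local Open Scope classical_set_scope.
Local Open Scope ring_scope.

Definition rV_display : measure_display -> measure_display.
Proof. exact. Qed.

Section measurable_rV.
Context d (T : measurableType d) (n : nat).
Let coors : 'I_n -> 'rV[T]_n -> T := fun i x => x ord0 i.

Let rV_set0 : g_sigma_preimage coors set0.
Proof. exact: sigma_algebra0. Qed.

Let rV_setC A : g_sigma_preimage coors A -> g_sigma_preimage coors (~` A).
Proof. exact: sigma_algebraC. Qed.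

Let rV_bigcup (F : _^nat) : (forall i, g_sigma_preimage coors (F i)) ->
  g_sigma_preimage coors (\bigcup_i (F i)).
Proof. exact: sigma_algebra_bigcup. Qed.

HB.instance Definition _ := @isMeasurable.Build (rV_display d)
  'rV[T]_n (g_sigma_preimage coors) rV_set0 rV_setC rV_bigcup.

Lemma measurable_coor (i : 'I_n) :
  measurable_fun [set: 'rV[T]_n] (fun x : 'rV[T]_n => x ord0 i).
Proof.
move=> _ Y mY; rewrite setTI; apply: sub_sigma_algebra => /=.
rewrite -bigcup_seq/=; exists i => /=; first by rewrite mem_index_enum.
by exists Y => //; rewrite setTI.
Qed.

End measurable_rV.

Section measurable_fun_rV.
Context d1 d2 (T1 : measurableType d1) (T : measurableType d2).

Lemma measurable_fun_rVP n (f : T1 -> 'rV[T]_n) :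
  (forall i, measurable_fun [set: T1] (fun x => f x ord0 i)) ->
  measurable_fun [set: T1] f.
Proof.
move=> mf _ A mA; rewrite setTI; move: A mA.
suff : (measurable : set (set 'rV[T]_n)) `<=` [set A | measurable (f @^-1` A)].
  by [].
apply: smallest_sub.
  split.
  - by rewrite /= preimage_set0.
  - by move=> A /= mA; rewrite setTD preimage_setC; exact: measurableC.
  - by move=> F /= mF; rewrite preimage_bigcup; exact: bigcupT_measurable.
move=> A; rewrite -bigcup_seq => -[i /= _ [B mB <-]] /=.
by have := mf i measurableT _ mB; rewrite !setTI.
Qed.

End measurable_fun_rV.

Section lebesgue_Rn.
Context (R : realType).

Definition cons_rV n (p : measurableTypeR R * 'rV[R]_n) : 'rV[R]_n.+1 :=
  row_mx (const_mx p.1 : 'rV[R]_1) p.2.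

Definition uncons_rV n (v : 'rV[R]_n.+1) : measurableTypeR R * 'rV[R]_n :=
  (v ord0 ord0, \row_i v ord0 (lift ord0 i)).

Lemma cons_rV0 n p : @cons_rV n p ord0 ord0 = p.1.
Proof.
have := @row_mxEl R 1 1 n (const_mx p.1) p.2 ord0 ord0.
by rewrite [RHS]mxE => <-; congr (row_mx _ _ _ _); exact/val_inj.
Qed.

Lemma cons_rVS n p i : @cons_rV n p ord0 (lift ord0 i) = p.2 ord0 i.
Proof.
have <- := @row_mxEr R 1 1 n (const_mx p.1) p.2 ord0 i.
by congr (row_mx _ _ _ _); exact/val_inj.
Qed.

Lemma cons_rVK n : cancel (@cons_rV n) (@uncons_rV n).
Proof.
case=> x v; rewrite /uncons_rV cons_rV0/=; congr pair.
by apply/rowP => i; rewrite mxE cons_rVS.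
Qed.

Lemma uncons_rVK n : cancel (@uncons_rV n) (@cons_rV n).
Proof.
move=> v; apply/rowP => i; case: (unliftP ord0 i) => [j|] ->.
  by rewrite cons_rVS mxE.
by rewrite cons_rV0.
Qed.

Lemma measurable_cons_rV n : measurable_fun [set: _] (@cons_rV n).
Proof.
apply: measurable_fun_rVP => i; case: (unliftP ord0 i) => [j|] ->.
  under eq_fun do rewrite cons_rVS.
  apply: (measurableT_comp (f := fun x : 'rV[R]_n => x ord0 j)) => //.
  exact: measurable_coor.
under eq_fun do rewrite cons_rV0.
exact: (@measurable_fst _ _ (measurableTypeR R) 'rV[R]_n).
Qed.

Lemma measurable_uncons_rV n : measurable_fun [set: _] (@uncons_rV n).
Proof.
apply: measurable_fun_pair; first exact: measurable_coor.
apply: measurable_fun_rVP => i /=; under eq_fun do rewrite mxE.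
exact: measurable_coor.
Qed.

Section step.
Context n (m : {sigma_finite_measure set 'rV[R]_n -> \bar R}).
Local Open Scope ereal_scope.

Definition lebesgue_step : set 'rV[R]_n.+1 -> \bar R :=
  pushforward (lebesgue_measure \x m) (@cons_rV n).

Let step0 : lebesgue_step set0 = 0.
Proof. by rewrite /lebesgue_step /pushforward preimage_set0 measure0. Qed.

Let step_ge0 A : 0 <= lebesgue_step A.
Proof. by rewrite /lebesgue_step /pushforward; exact: measure_ge0. Qed.

Let step_sigma_additive : semi_sigma_additive lebesgue_step.
Proof.
move=> F mF tF mUF; rewrite /lebesgue_step /pushforward preimage_bigcup.
have mc := @measurable_cons_rV n.
apply: measure_semi_sigma_additive.
- by move=> k; rewrite -[X in measurable X]setTI; exact: mc.
- apply/trivIsetP => /= i j _ _ ij; rewrite -preimage_setI.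
  by move/trivIsetP : tF => /(_ _ _ _ _ ij) ->//; rewrite preimage_set0.
- by rewrite -preimage_bigcup -[X in measurable X]setTI; exact: mc.
Qed.

HB.instance Definition _ := isMeasure.Build _ _ _ lebesgue_step
  step0 step_ge0 step_sigma_additive.

Let step_sigma_finite : sigma_finite setT lebesgue_step.
Proof.
have [F TF Foo] : sigma_finite setT (lebesgue_measure \x m).
  have /sigma_finiteP[F [TF ndF Foo]] := sigma_finiteT (@lebesgue_measure R).
  have /sigma_finiteP[G [TG ndG Goo]] := sigma_finiteT m.
  exists (fun k => F k `*` G k).
    rewrite -setXTT TF TG predeqE => -[x y]; split.
      move=> [/= [i _ Fix] [k _ Gky]]; exists (maxn i k) => //; split.
      - by move: x Fix; exact/subsetPset/ndF/leq_maxl.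
      - by move: y Gky; exact/subsetPset/ndG/leq_maxr.
    by move=> [i _ []/= ? ?]; split; exists i.
  move=> k; have [? ?] := Foo k; have [? ?] := Goo k.
  split; first exact: measurableX.
  by rewrite product_measure1E// lte_mul_pinfty// ge0_fin_numE.
exists (fun k => @uncons_rV n @^-1` F k).
  by rewrite -preimage_bigcup -TF preimage_setT.
move=> k; have [mF Fk] := Foo k; split.
  by rewrite -[X in measurable X]setTI; exact: measurable_uncons_rV.
rewrite /lebesgue_step /pushforward -comp_preimage.
rewrite (_ : _ \o _ = id)//.
by apply/funext => p; exact: cons_rVK.
Qed.

HB.instance Definition _ := Measure_isSigmaFinite.Build _ _ _ lebesgue_step
  step_sigma_finite.
End step.

Fixpoint lebesgue_Rn n : {sigma_finite_measure set 'rV[R]_n -> \bar R} :=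
  if n is k.+1 then lebesgue_step (lebesgue_Rn k)
  else \d_(0 : 'rV[R]_0).

Lemma lebesgue_Rn_box n (A : 'I_n -> set R) : (forall i, measurable (A i)) ->
  lebesgue_Rn n [set v : 'rV[R]_n | forall i, A i (v ord0 i)] =
    (\prod_(i < n) lebesgue_measure (A i))%E.
Proof.
elim: n A => [|n IH] A mA.
  rewrite big_ord0 /= diracE mem_set//= => i.
  by have := ltn_ord i.
have mbox : measurable
    [set v : 'rV[R]_n | forall i, A (lift ord0 i) (v ord0 i)].
  rewrite [X in measurable X](_ : _ = \big[setI/setT]_(i < n)
      ((fun v : 'rV[R]_n => v ord0 i) @^-1` A (lift ord0 i))).
    apply: bigsetI_measurable => i _; rewrite -[X in measurable X]setTI.
    exact: measurable_coor.
  rewrite -bigcap_seq; apply/seteqP; split=> v /= h i; last first.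
    by apply: h => /=; rewrite mem_index_enum.
  by move=> _; exact: h.
rewrite big_ord_recl -IH => [|i]; last exact: mA.
rewrite -product_measure1E; [|exact: mA|exact: mbox].
rewrite /= /lebesgue_step /pushforward; congr (product_measure1 _ _ _).
apply/seteqP; split=> -[x v] /=.
  by move=> h; split=> [|i]; [have := h ord0; rewrite cons_rV0|
     have := h (lift ord0 i); rewrite cons_rVS].
move=> [h0 h] i; case: (unliftP ord0 i) => [j|] ->.
  by rewrite cons_rVS; exact: h.
by rewrite cons_rV0.
Qed.

End lebesgue_Rn.

Section smooth_functions.
Context (R : realType) (V : normedModType R).
Implicit Types f : V -> R.

Definition pderiv (v : V) f : V -> R := fun z => 'D_v f z.

Definition smooth f := forall (s : seq V) (z : V),
  differentiable (foldr pderiv f s) z.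

Definition multi_order d (alpha : 'I_d -> nat) : nat := (\sum_i alpha i)%N.

Definition multi_pderiv d (e : 'I_d -> V) (alpha : 'I_d -> nat) f : V -> R :=
  foldr (fun i g => iter (alpha i) (pderiv (e i)) g) f (enum 'I_d).

End smooth_functions.

Section complex_valued.
Context (R : realType).
Local Open Scope complex_scope.

Definition expi (theta : R) : R[i] := cos theta +i* sin theta.

Definition cintegrable dsp (T : measurableType dsp)
    (m : {measure set T -> \bar R}) (D : set T) (f : T -> R[i]) :=
  m.-integrable D (fun x => (complex.Re (f x))%:E) /\
  m.-integrable D (fun x => (complex.Im (f x))%:E).

Definition cintegral dsp (T : measurableType dsp)
    (m : {measure set T -> \bar R}) (D : set T) (f : T -> R[i]) : R[i] :=
  Complex (\int[m]_(x in D) complex.Re (f x)) (\int[m]_(x in D) complex.Im (f x)).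

End complex_valued.

Section Rd.
Context (R : realType) (d : nat).
Local Open Scope complex_scope.
Local Notation V := 'rV[R]_d.
Local Notation C := R[i].
Local Notation mu := (lebesgue_Rn R d).
Implicit Types (f g : V -> C) (x xi : V).

(* The norm that the library puts on row vectors is the maximum norm. *)
Definition dotp x xi : R := \sum_i x 0 i * xi 0 i.
Definition enorm x : R := Num.sqrt (dotp x x).

Definition opnorm (M : 'M[R]_d) : R :=
  sup [set enorm (v *m M) | v in [set v : V | enorm v <= 1]].

Definition basis_vec (i : 'I_d) : V := delta_mx 0 i.

Definition cmeasurable f :=
  measurable_fun setT (fun x => complex.Re (f x)) /\
  measurable_fun setT (fun x => complex.Im (f x)).

Definition eL2norm f : \bar R := 'N[mu]_2%:E[EFin \o (@normc R \o f)]%E.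
Definition L2norm f : R := fine (eL2norm f).
Definition inL2 f := cmeasurable f /\ (eL2norm f < +oo)%E.
Definition eqL2 f g := f = g %[ae mu].
Definition inner f g : C := cintegral mu setT (fun x => f x * (g x)^*).

Definition weakly_cvgL2 (F : nat -> V -> C) f := forall g, inL2 g ->
  (fun n => normc (inner (F n) g - inner f g)) @ \oo --> (0 : R).

(* By Tonelli this is the norm of L^q(I x R^d).  As an iterated integral it does
   not depend on the representatives chosen for the classes [u t]. *)
Definition Lq_tx (q : R) (I : set R) (u : R -> V -> C) : \bar R :=
  ((\int[lebesgue_measure]_(t in I) \int[mu]_x (normc (u t x) `^ q)%:E)
     `^ q^-1)%E.

(* An operator on L^2 is a map on functions; linearity and isometry make it
   compatible with a.e. equality. *)
Definition unitaryL2 (T : (V -> C) -> (V -> C)) :=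
  [/\ forall f, inL2 f -> inL2 (T f),
      forall (k : C) f g, inL2 f -> inL2 g ->
        eqL2 (T (fun x => k * f x + g x)) (fun x => k * T f x + T g x),
      forall f, inL2 f -> L2norm (T f) = L2norm f
    & forall g, inL2 g -> exists2 f, inL2 f & eqL2 (T f) g].

(* The inverse of a unitary operator (well defined up to a.e. equality). *)
Definition invL2 (T : (V -> C) -> (V -> C)) g : V -> C :=
  xget (fun=> 0) [set f | inL2 f /\ eqL2 (T f) g].

Definition tf_shift x0 xi0 f : V -> C :=
  fun x => expi (dotp (x - x0) xi0) * f (x - x0).
Definition tf_shift_inv x0 xi0 f : V -> C :=
  fun x => expi (- dotp x xi0) * f (x + x0).

Definition dilation (lambda : R) f : V -> C :=
  fun x => (lambda `^ (- (d%:R / 2)))%:C * f (lambda^-1 *: x).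
Definition dilation_inv (lambda : R) f : V -> C :=
  fun x => (lambda `^ (d%:R / 2))%:C * f (lambda *: x).

Lemma expiN_expi (theta : R) : expi (- theta) * expi theta = 1.
Proof.
rewrite /expi cosN sinN; apply/eqP; rewrite eq_complex /= !mulNr opprK.
by rewrite -!expr2 cos2Dsin2 eqxx/= [cos _ * _]mulrC subrr.
Qed.

Lemma tf_shiftK x0 xi0 : cancel (tf_shift x0 xi0) (tf_shift_inv x0 xi0).
Proof.
move=> f; apply/funext => x.
by rewrite /tf_shift_inv /tf_shift addrK mulrA expiN_expi mul1r.
Qed.

Lemma tf_shift_invK x0 xi0 : cancel (tf_shift_inv x0 xi0) (tf_shift x0 xi0).
Proof.
move=> f; apply/funext => x.
by rewrite /tf_shift_inv /tf_shift subrK mulrA [expi _ * _]mulrC expiN_expi mul1r.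
Qed.

Lemma dilationK (lambda : R) : 0 < lambda ->
  cancel (dilation lambda) (dilation_inv lambda).
Proof.
move=> l0 f; apply/funext => x; rewrite /dilation_inv /dilation.
rewrite scalerA mulVf ?gt_eqF// scale1r mulrA -rmorphM -powRD; last first.
  by apply/implyP => _; rewrite gt_eqF.
by rewrite subrr powRr0 mul1r.
Qed.

Lemma dilation_invK (lambda : R) : 0 < lambda ->
  cancel (dilation_inv lambda) (dilation lambda).
Proof.
move=> l0 f; apply/funext => x; rewrite /dilation_inv /dilation.
rewrite scalerA mulfV ?gt_eqF// scale1r mulrA -rmorphM -powRD; last first.
  by apply/implyP => _; rewrite gt_eqF.
by rewrite addNr powRr0 mul1r.
Qed.

Definition gaussian : V -> C := fun x =>
  (2 `^ (- (d%:R / 2)) * pi `^ (- (3 * d%:R / 4)) *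
   expR (- (enorm x ^+ 2 / 2)))%:C.

Definition wave_packet x0 xi0 : V -> C := tf_shift x0 xi0 gaussian.

Definition strichartz_norm (u : R -> V -> C) : \bar R :=
  Lq_tx (2 * (d%:R + 2) / d%:R) `[-1, 1] u.

Definition wave_packet_sup (u : R -> V -> C) : \bar R :=
  ereal_sup [set y | exists (lambda t : R) x0 xi0,
    [/\ 0 < lambda <= 1, `|t| <= 1 &
      y = (normc (inner (dilation lambda (wave_packet x0 xi0)) (u t)))%:E]].

Definition schwartzR (f : V -> R) :=
  smooth f /\ forall alpha beta : 'I_d -> nat, exists M : R, forall x,
    `|(\prod_i x 0 i ^+ alpha i) * multi_pderiv basis_vec beta f x| <= M.

Definition schwartz g :=
  schwartzR (fun x => complex.Re (g x)) /\ schwartzR (fun x => complex.Im (g x)).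

(* For [g] Schwartz and [b] smooth with bounded derivatives of order at least 2,
   the [y]-integral converges absolutely and decays rapidly in [xi], so that the
   oscillatory integral is an iterated Lebesgue integral. *)
Definition weyl (b : V -> V -> R) g : V -> C := fun x =>
  ((2 * pi) ^- d)%:C *
  cintegral mu setT (fun xi => cintegral mu setT (fun y =>
    expi (dotp (x - y) xi) * (b (2^-1 *: (x + y)) xi)%:C * g y)).

Definition dx_vec (i : 'I_d) : V * V := (basis_vec i, 0).
Definition dxi_vec (i : 'I_d) : V * V := (0, basis_vec i).

Definition hess_xi (b : V -> V -> R) x xi : 'M[R]_d :=
  \matrix_(i, j) pderiv (basis_vec i) (pderiv (basis_vec j) (b x)) xi.

Record admissible (c : ('I_d -> nat) -> ('I_d -> nat) -> R) (eps0 : R)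
    (a : R -> V -> V -> R) : Prop := Admissible {
  admissible_meas : forall x xi, measurable_fun setT (fun t : R => a t x xi) ;
  admissible_smooth : forall t, smooth (fun z : V * V => a t z.1 z.2) ;
  admissible_bound : forall alpha beta : 'I_d -> nat,
    (2 <= multi_order alpha + multi_order beta)%N ->
    forall (t : R) (z : V * V),
      `|multi_pderiv dx_vec alpha (multi_pderiv dxi_vec beta
          (fun z : V * V => a t z.1 z.2)) z| <= c alpha beta ;
  admissible_nondeg : forall t x xi,
    `| `|\det (hess_xi (a t) x xi)| - 1| + `|opnorm (hess_xi (a t) x xi) - 1|
      <= eps0
}.

(* [(D_t + a^w) u = 0] in the sense of distributions, integrated in time: for
   every Schwartz [g], [<u(t), g>] is an indefinite integral of
   [- i <a^w u, g> = - i <u, a^w g>], as [a] is real. *)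
Definition solves (a : R -> V -> V -> R) (u : R -> V -> C) :=
  forall g, schwartz g -> forall t1 t2 : R, t1 <= t2 ->
    let F r := inner (u r) (weyl (a r) g) in
    cintegrable lebesgue_measure `[t1, t2] F /\
    inner (u t2) g - inner (u t1) g =
      - 'i * cintegral lebesgue_measure `[t1, t2] F.

Definition propagator (a : R -> V -> V -> R) (U : R -> R -> (V -> C) -> V -> C) :=
  (forall t s, unitaryL2 (U t s)) /\
  (forall s f, inL2 f -> eqL2 (U s s f) f /\ solves a (fun t => U t s f)).

End Rd.

(* Main.v *)
Require Import Defs.
From HB Require Import structures.
From mathcomp Require Import all_boot all_order all_algebra.
From mathcomp Require Import complex.
From mathcomp Require Import all_classical all_reals all_analysis.
From mathcomp Require Import measurable_realfun.
From mathcomp Require Import ring lra.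
Set Implicit Arguments. Unset Strict Implicit. Unset Printing Implicit Defensive.
Import Order.TTheory GRing.Theory Num.Theory.
Import numFieldNormedType.Exports Normc.
Local Open Scope classical_set_scope.
Local Open Scope ring_scope.

(** The refined Strichartz estimate says that a solution with a large space-time
    norm has a large inner product with some wave packet at some time.  Given
    the lower bound [eps] on the space-time norm and the upper bound [A] on the
    mass, solving the estimate for the supremum gives parameters
    [(lambda_n, t_n, x_n, xi_n)] for which this inner product is at least
    [B], a constant times [eps * (eps / A) `^ ((1 - theta) / theta)]
    ([wave_packet_concentration]).

    Undo the symmetries: [g_n = pi(x_n, xi_n)^-1 S_{lambda_n}^-1 u_n(t_n)] has
    the same L^2 norm as [f_n], and its inner product with the fixed Gaussian
    [psi] is at least [B] in modulus ([inner_tf_dilation]).  Bounded sequences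
    of L^2 have weakly convergent subsequences ([L2_weak_compact]); the weak
    limit [phi] inherits the lower bound on [<psi, phi>], and Cauchy-Schwarz
    turns it into a lower bound on the norm of [phi].

    The decoupling of the masses involves norms only.  As the propagator,
    the dilations and the time-frequency shifts are isometric, the three norms
    in the last claim are those of [g_n], [g_n - phi] and [phi], and
    [|g_n|^2 - |g_n - phi|^2 - |phi|^2 = 2 Re <g_n - phi, phi>] tends to zero
    by weak convergence.

    Two bodies of theory carry this.  Weak compactness is proved for a complete
    semi-inner product ([hilbert_weak_compact]), by a diagonal extraction and
    the Riesz representation theorem, and is applied to real L^2 spaces, which
    are complete by [riesz_fischer].  The isometries rest on the affine change
    of variables for the iterated Lebesgue measure
    ([integral_lebesgue_Rn_affine]), by induction on the dimension. *)

(** * Subsequences and diagonal extraction *)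

Lemma homo_ltn_ge (s : nat -> nat) : {homo s : m n / (m < n)%N} ->
  forall n, (n <= s n)%N.
Proof. by move=> hs; elim=> // n ih; exact: leq_ltn_trans ih (hs _ _ _). Qed.

Lemma cvg_subseq (T : topologicalType) (u : nat -> T) (l : T) (s : nat -> nat) :
  (forall n, (n <= s n)%N) -> u @ \oo --> l -> (u \o s) @ \oo --> l.
Proof.
move=> hs ul; apply: cvg_comp ul; move=> A [N _ NA].
by exists N => // n /= Nn; apply: NA => /=; exact: leq_trans Nn (hs n).
Qed.

Section diagonal_extraction.
Context {R : realType}.

Lemma bounded_subseq (u : nat -> R) (K : R) : (forall n, `|u n| <= K) ->
  exists2 s : nat -> nat, {homo s : m n / (m < n)%N} & cvgn (u \o s).
Proof.
move=> uK; have [|s s_incr us] := @bolzano_weierstrass R u.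
  exists K; split; first exact: num_real.
  by move=> M KM n _ /=; rewrite (le_trans (uK n))// ltW.
exists s => // m n mn; rewrite ltnNge; apply/negP => h.
by move: (s_incr n m); rewrite !leEnat h => /esym; rewrite leqNgt mn.
Qed.

(** Cantor's diagonal argument: [t k.+1] refines [t k] so that the [k]-th sequence
    converges along it; along [n |-> t n n] every sequence then converges, as from
    the index [k.+1] on this is a subsequence of [t k.+1]. *)
Lemma diagonal_subseq (a : nat -> nat -> R) (K : nat -> R) :
  (forall k n, `|a k n| <= K k) ->
  exists2 s : nat -> nat, {homo s : m n / (m < n)%N} &
    forall k, cvgn (a k \o s).
Proof.
move=> aK.
have step (kt : nat * (nat -> nat)) : exists s' : nat -> nat,
    {homo s' : m n / (m < n)%N} /\ cvgn (a kt.1 \o (kt.2 \o s')).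
  have [|s hs cs] := @bounded_subseq (a kt.1 \o kt.2) (K kt.1).
    by move=> n; exact: aK.
  by exists s.
have [f fP] := choice step.
pose t := fix t k := if k is k'.+1 then t k' \o f (k', t k') else id.
have t_homo k : {homo t k : m n / (m < n)%N}.
  elim: k => // k ih m n mn /=; apply: ih.
  by have [h _] := fP (k, t k); exact: h.
have t_tail k i : exists2 g : nat -> nat, (forall n, (n <= g n)%N) &
    t (k + i)%N = t k \o g.
  elim: i => [|i [g hg e]]; first by exists id => //; rewrite addn0.
  have [h _] := fP ((k + i)%N, t (k + i)%N).
  exists (g \o f ((k + i)%N, t (k + i)%N)).
    move=> n /=; apply: leq_trans (hg _); exact: homo_ltn_ge.
  by rewrite addnS /= e.
exists (fun n => t n n).
  apply: homo_ltn => [m n p|n]; first exact: ltn_trans.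
  rewrite /=; apply: t_homo; have [h _] := fP (n, t n).
  exact: homo_ltn_ge.
move=> k; have [_ /cvg_ex[l cl]] := fP (k, t k); apply/cvg_ex; exists l.
have /choice[g gP] : forall n, exists j, (n <= j)%N /\
    t (n + k.+1)%N (n + k.+1)%N = t k.+1 j.
  move=> n; have [g hg e] := t_tail k.+1 n.
  exists (g (n + k.+1)%N); split; last by rewrite addnC e.
  by apply: leq_trans (hg _); exact: leq_addr.
rewrite -(cvg_shiftn k.+1).
have -> : (fun n => (a k \o (fun n => t n n)) (n + k.+1)%N) =
          (a k \o (t k \o f (k, t k))) \o g.
  by apply/funext => n /=; have [_ ->] := gP n.
by apply: cvg_subseq cl => n; have [] := gP n.
Qed.

End diagonal_extraction.

(** * Semi-inner products *)

(** The discriminant criterion, in the form that yields Cauchy-Schwarz and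
    that forces the first variation to vanish at a minimum. *)
Lemma quadratic_ge0 {R : realType} (A B C : R) : 0 <= C ->
  (forall s : R, 0 <= A + 2 * s * B + s ^+ 2 * C) -> B ^+ 2 <= A * C.
Proof.
rewrite le0r => /orP[/eqP-> h|C0 h].
  rewrite mulr0; have [->|B0] := eqVneq B 0; first by rewrite expr0n.
  have := h (- (A + 1) / (2 * B)); rewrite mulr0 addr0.
  by rewrite (_ : _ + _ = -1) ?ler0N1//; field.
have := h (- B / C).
rewrite (_ : _ + _ = (A * C - B ^+ 2) / C); last by field; rewrite gt_eqF.
by rewrite pmulr_lge0 ?invr_gt0// subr_ge0.
Qed.

Lemma cvg_sqr0 {R : realType} (u v : nat -> R) : (forall n, u n ^+ 2 <= v n) ->
  v @ \oo --> (0 : R) -> u @ \oo --> (0 : R).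
Proof.
move=> uv /cvgr0Pnorm_lt v0; apply/cvgr0Pnorm_lt => e e0.
have := v0 _ (exprn_gt0 2 e0); apply: filterS => n.
rewrite ger0_norm; last by rewrite (le_trans _ (uv n))// sqr_ge0.
move=> /(le_lt_trans (uv n)) h; rewrite -(ltr_pXn2r (_ : 0 < 2)%N)// ?nnegrE//.
  by rewrite real_normK ?num_real.
exact: ltW.
Qed.

Section hilbert.
Context {R : realType} {E : lmodType R}.

(** Semi-definite rather than definite, so that the elements can be functions
    instead of classes modulo almost everywhere equality. *)
Record is_semi_hilbert (ip : E -> E -> R) : Prop := SemiHilbert {
  ipC : forall u v, ip u v = ip v u ;
  ipDl : forall u v w, ip (u + v) w = ip u w + ip v w ;
  ipZl : forall k u v, ip (k *: u) v = k * ip u v ;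
  ip_ge0 : forall u, 0 <= ip u u ;
  ip_complete : forall u : nat -> E,
    (forall e : R, 0 < e -> exists N, forall m n, (N <= m)%N -> (N <= n)%N ->
      ip (u m - u n) (u m - u n) <= e) ->
    exists v, (fun n => ip (u n - v) (u n - v)) @ \oo --> (0 : R)
}.

Context (ip : E -> E -> R) (H : is_semi_hilbert ip).

Lemma ipDr u v w : ip w (u + v) = ip w u + ip w v.
Proof. by rewrite (ipC H) (ipDl H) !(ipC H w). Qed.
Lemma ipZr k u v : ip v (k *: u) = k * ip v u.
Proof. by rewrite (ipC H) (ipZl H) (ipC H). Qed.
Lemma ipNl u v : ip (- u) v = - ip u v.
Proof. by rewrite -scaleN1r (ipZl H) mulN1r. Qed.
Lemma ipNr u v : ip v (- u) = - ip v u.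
Proof. by rewrite -scaleN1r ipZr mulN1r. Qed.
Definition ipE := (ipDl H, ipDr, ipZl H, ipZr, ipNl, ipNr).

Lemma ip_cauchy_schwarz u v : ip u v ^+ 2 <= ip u u * ip v v.
Proof.
apply: quadratic_ge0; first exact: (ip_ge0 H).
move=> s; have := ip_ge0 H (u + s *: v); rewrite !ipE (ipC H v u).
by move=> h; nra.
Qed.

Definition ip_cvg (u : nat -> E) v :=
  (fun n => ip (u n - v) (u n - v)) @ \oo --> (0 : R).

Lemma ip_cvgl u v w : ip_cvg u v -> (fun n => ip (u n) w) @ \oo --> ip v w.
Proof.
move=> uv; have : (fun n => ip (u n - v) w) @ \oo --> (0 : R).
  apply: (@cvg_sqr0 _ _ (fun n => ip (u n - v) (u n - v) * ip w w)) => [n|].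
    exact: ip_cauchy_schwarz.
  rewrite -[X in _ --> X](mul0r (ip w w)).
  apply: cvgM; [exact: uv|exact: cvg_cst].
move=> /(cvgD (cvg_cst (ip v w))); rewrite addr0; apply: cvg_trans.
apply: near_eq_cvg; apply: nearW => n.
by rewrite !fctE !ipE; lra.
Qed.

Section riesz.
Context (D : set E) (D0 : D 0)
  (D_lin : forall k u v, D u -> D v -> D (k *: u + v))
  (D_closed : forall u v, (forall n, D (u n)) -> ip_cvg u v -> D v).

(** The representative minimises [J v = |v|^2 - 2 L v] over the closed subspace
    [D].  A minimising sequence is Cauchy by the parallelogram identity, and at
    the limit the inequality [m <= J (v + s w)], quadratic in [s], forces the
    linear term to vanish. *)
Lemma riesz (L : E -> R) (K : R) : 0 <= K ->
  (forall k u v, D u -> D v -> L (k *: u + v) = k * L u + L v) ->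
  (forall u, D u -> L u ^+ 2 <= K * ip u u) ->
  exists2 p, D p & forall v, D v -> ip p v = L v.
Proof.
move=> K0 L_lin LK; pose J v := ip v v - 2 * L v.
have JK v : D v -> - K <= J v.
  move=> Dv; have q0 := ip_ge0 H v.
  have : (2 * L v) ^+ 2 <= (ip v v + K) ^+ 2 
    by have := LK _ Dv; have := sqr_ge0 (ip v v - K); rewrite !expr2; lra.
  by rewrite -ler_sqrt ?sqr_ge0// !sqrtr_sqr [X in _ <= X]ger0_norm ?addr_ge0//;
    rewrite /J; move: (ler_norm (2 * L v)); lra.
have J_inf : has_inf [set J v | v in D].
  split; first by exists (J 0), 0.
  by exists (- K) => _ [v Dv <-]; exact: JK.
pose m := inf [set J v | v in D].
have mJ v : D v -> m <= J v.
  by move=> Dv; apply: ge_inf; [exact: J_inf.2|exists v].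
have /choice[u uP] : forall n : nat, exists v, D v /\ J v < m + n.+1%:R^-1.
  move=> n; have [|_ [v Dv <-] Jv] := @inf_adherent _ _ n.+1%:R^-1 _ J_inf.
    by rewrite invr_gt0.
  by exists v.
have Du n : D (u n) by have [] := uP n.
have DZ k v : D v -> D (k *: v).
  by move=> Dv; have := D_lin k Dv D0; rewrite addr0.
have L0 : L 0 = 0.
  by have := L_lin 1 _ _ D0 D0; rewrite scaler0 addr0; lra.
have LZ k v : D v -> L (k *: v) = k * L v.
  by move=> Dv; have := L_lin k _ _ Dv D0; rewrite !addr0 L0 addr0.
(* Parallelogram identity at the midpoint, where [J] is at least [m]:
   |u_i - u_j|^2 <= 2 (J u_i - m) + 2 (J u_j - m). *)
have [|p up] := ip_complete H (u := u).
  move=> e e0; have [N Ne] : exists N : nat, 4 * N.+1%:R^-1 <= e.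
    have := @cvg_harmonic R => /cvgr0Pnorm_le /(_ (e / 4)).
    rewrite divr_gt0// => /(_ isT)[N _ NP]; exists N.
    have := NP N (leqnn N); rewrite /= /harmonic ger0_norm ?invr_ge0//.
    by move: (N.+1%:R^-1) => y; lra.
  exists N => i j Ni Nj; apply: le_trans Ne.
  have [Di Ji] := uP i; have [Dj Jj] := uP j.
  have Dij : D (2^-1 *: (u i + u j)).
    by apply: DZ; have := D_lin 1 Di Dj; rewrite scale1r.
  have := mJ _ Dij; rewrite /J LZ; last first.
    by have := D_lin 1 Di Dj; rewrite scale1r.
  have := L_lin 1 _ _ Di Dj; rewrite scale1r mul1r => ->.
  have inv_le k : (N <= k)%N -> k.+1%:R^-1 <= N.+1%:R^-1 :> R.
    by move=> Nk; rewrite lef_pV2 ?posrE// ler_nat.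
  have := inv_le _ Ni; have := inv_le _ Nj; move: Ji Jj; rewrite /J !ipE.
  rewrite (ipC H (u j)); move: (i.+1%:R^-1) (j.+1%:R^-1) (N.+1%:R^-1).
  by move=> x y z; lra.
exists p; first exact: D_closed up.
move=> v Dv; apply/eqP; rewrite -subr_eq0 -sqrf_eq0.
(* The constant coefficient of the quadratic is 0, which is what makes the
   discriminant bound an equality. *)
suff : (ip p v - L v) ^+ 2 <= 0 * ip v v.
  by rewrite mul0r => h; rewrite eq_le h sqr_ge0.
apply: quadratic_ge0 => [|s]; first exact: (ip_ge0 H).
have c : (fun n : nat => n.+1%:R^-1 + 2 * s * (ip (u n) v - L v) +
      s ^+ 2 * ip v v) @ \oo --> 0 + 2 * s * (ip p v - L v) + s ^+ 2 * ip v v.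
  apply: cvgD; last exact: cvg_cst.
  apply: cvgD; first exact: cvg_harmonic.
  apply: cvgM; first exact: cvg_cst.
  by apply: cvgB; [exact: ip_cvgl up|exact: cvg_cst].
rewrite -(cvg_lim _ c)//; apply: limr_ge.
  by apply/cvg_ex; eexists; exact: c.
apply: nearW => n; have [Dn Jn] := uP n.
have := mJ _ (D_lin s Dv Dn); rewrite /J L_lin// !ipE (ipC H v).
by move: Jn; rewrite /J; move: (n.+1%:R^-1) => x; lra.
Qed.

End riesz.

(** Extract [h] so that [<h_n, h_k>] converges in [n] for each [k], and let [D] be
    the set of all [v] for which [<h_n, v>] converges.  It is a closed subspace
    containing every [h_n], and Riesz represents the limit functional by some
    [phi] in [D].  For an arbitrary [v], Riesz applied to [<v, .>] on [D] is the
    orthogonal projection [p] of [v] onto [D]; then [<h_n, v> = <h_n, p>], and the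
    limit [<phi, p>] equals [<phi, v>].  Working in [D]
    replaces the choice of a countable dense set. *)
Theorem hilbert_weak_compact (g : nat -> E) (K : R) :
  (forall n, ip (g n) (g n) <= K) ->
  exists2 s : nat -> nat, {homo s : m n / (m < n)%N} &
    exists p, forall v, (fun n => ip (g (s n)) v) @ \oo --> ip p v.
Proof.
move=> gK; have K0 : 0 <= K by apply: le_trans (gK 0%N); exact: (ip_ge0 H).
have gv_le n v : ip (g n) v ^+ 2 <= K * ip v v.
  by apply: le_trans (ip_cauchy_schwarz _ _) _; rewrite ler_wpM2r// (ip_ge0 H).
have [k n|s s_homo cs] :=
    @diagonal_subseq R (fun k n => ip (g n) (g k)) (fun=> K).
  rewrite -(@ler_pXn2r _ 2)// ?nnegrE// real_normK ?num_real//.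
  by apply: le_trans (gv_le n (g k)) _; rewrite expr2 ler_wpM2l.
exists s => //; pose h := g \o s.
pose D := [set v | cvgn (fun n => ip (h n) v)].
pose L v : R := limn (fun n => ip (h n) v).
have DL v : D v -> (fun n => ip (h n) v) @ \oo --> L v by [].
have lin k u v : D u -> D v ->
    (fun n => ip (h n) (k *: u + v)) @ \oo --> k * L u + L v.
  move=> Du Dv; rewrite (_ : (fun n => _) =
      (fun n => k * ip (h n) u + ip (h n) v)); last first.
    by apply/funext => n; rewrite !ipE.
  by apply: cvgD; [apply: cvgM; [exact: cvg_cst|exact: DL]|exact: DL].
have D_lin k u v : D u -> D v -> D (k *: u + v).
  by move=> Du Dv; apply/cvg_ex; eexists; exact: lin.
have D0 : D 0.
  apply/cvg_ex; exists 0; rewrite (_ : (fun n => _) = fun=> 0).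
    exact: cvg_cst.
  by apply/funext => n; rewrite -(scale0r 0) ipZr mul0r.
have L_lin k u v : D u -> D v -> L (k *: u + v) = k * L u + L v.
  by move=> Du Dv; apply/cvg_lim => //; exact: lin.
have LK u : D u -> L u ^+ 2 <= K * ip u u.
  move=> Du; have c : (fun n => ip (h n) u * ip (h n) u) @ \oo --> L u * L u.
    by apply: cvgM; exact: DL.
  rewrite expr2 -(cvg_lim _ c)//; apply: limr_le.
    by apply/cvg_ex; eexists; exact: c.
  by apply: nearW => n; rewrite /= -expr2; exact: gv_le.
(* [<h_n, v>] is within [e / 2] of [<h_n, u_N>] uniformly in [n], because [h] is
   bounded; and [<h_n, u_N>] is eventually within [e / 2] of its limit. *)
have D_closed u v : (forall n, D (u n)) -> ip_cvg u v -> D v.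
  move=> Du uv; apply/cauchy_cvgP/cauchy_exP => e e0.
  have K10 : 0 < K + 1 by lra.
  have e40 : 0 < (e / 2) ^+ 2 / (K + 1).
    by rewrite divr_gt0// exprn_gt0// divr_gt0.
  have /cvgr0Pnorm_lt /(_ _ e40)[N _ /(_ N (leqnn N)) /=] := uv.
  rewrite ger0_norm ?(ip_ge0 H)// ltr_pdivlMr// => uNv.
  have e20 : 0 < e / 2 by rewrite divr_gt0.
  have /cvgrPdist_lt /(_ _ e20) b := DL _ (Du N).
  exists (L (u N)); rewrite /nbhs/=; apply: filterS b => n Lu.
  rewrite /ball/=.
  have : `|ip (h n) (u N - v)| < e / 2.
    rewrite -(ltr_pXn2r (_ : 0 < 2)%N)// ?nnegrE ?divr_ge0 ?ltW//.
    rewrite real_normK ?num_real//; apply: le_lt_trans (gv_le _ _) _.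
    have := ip_ge0 H (u N - v); nra.
  rewrite !ipE; have := ler_normD (L (u N) - ip (h n) (u N))
    (ip (h n) (u N) - ip (h n) v).
  rewrite addrA subrK; move: Lu => /=; lra.
have [phi Dphi phiP] := riesz D0 D_lin D_closed K0 L_lin LK.
exists phi => v.
have [||| p Dp pP] := @riesz D D0 D_lin D_closed (ip v) (ip v v).
- exact: (ip_ge0 H).
- by move=> k x y _ _; rewrite !ipE.
- by move=> x _; exact: ip_cauchy_schwarz.
have Dg n : D (h n).
  rewrite /D/= (_ : (fun _ => _) = (fun k => ip (g k) (h n)) \o s)//.
  exact: cs.
rewrite (ipC H phi) -pP// (ipC H p) phiP//.
rewrite (_ : (fun n => _) = (fun n => ip (h n) p)); first exact: DL.
by apply/funext => n; rewrite -[g (s n)]/(h n) (ipC H _ v) -pP// (ipC H).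
Qed.

End hilbert.

(** * Completeness and weak compactness of real L^2 *)

Section riesz_fischer.
Context {R : realType}.

Lemma cvg_geometric_increments (v : nat -> R) (M : R) :
  (forall k, `|v k.+1 - v k| <= M / 2 ^+ k) -> cvgn v.
Proof.
move=> vM; have M0 : 0 <= M by have := vM 0%N; rewrite divr1; exact: le_trans.
have c : cvgn (series (fun k => v k.+1 - v k)).
  apply: normed_cvg; rewrite /normed_series_of/=.
  apply: (@series_le_cvg _ _ (geometric M 2^-1)) => [k|k|k|].
  - exact: normr_ge0.
  - by rewrite /= mulr_ge0// exprn_ge0// invr_ge0.
  - by rewrite /= exprVn.
  - apply: is_cvg_geometric_series.
    by rewrite ger0_norm ?invr_ge0// invf_lt1// ltr1n.
rewrite (_ : v = (fun k => v 0%N + series (fun k => v k.+1 - v k) k)).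
  by apply: is_cvgD => //; exact: is_cvg_cst.
apply/funext; elim=> [|k ih]; first by rewrite seriesEnat/= big_geq// addr0.
by rewrite seriesSr addrA -ih; ring.
Qed.

Lemma limn_einf_le (u : nat -> \bar R) (l : \bar R) (N : nat) :
  (forall n, (N <= n)%N -> (u n <= l)%E) -> (limn_einf u <= l)%E.
Proof.
move=> ul; rewrite limn_einf_lim; apply: lime_le; first exact: is_cvg_einfs.
apply: nearW => n; apply: ereal_inf_le; exists (u (maxn n N)).
  by exists (maxn n N) => //=; exact: leq_maxl.
by apply: ul; exact: leq_maxr.
Qed.

Context d (T : measurableType d) (mu : {measure set T -> \bar R}).
Local Notation L2 := (@Lfun d T R mu 2%:E).

Lemma Lfun2P (f : T -> R) : f \in L2 <->
  measurable_fun setT f /\ (\int[mu]_x (f x ^+ 2)%:E < +oo)%E.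
Proof.
have sq : (\int[mu]_x (f x ^+ 2)%:E = 'N[mu]_2%:E[EFin \o f] `^ 2)%E.
  rewrite powR_Lnorm// => //; apply: eq_integral => x _.
  by rewrite /= powR_mulrn// real_normK ?num_real.
split=> [|[mf sf]].
  rewrite inE => /andP[/[!inE]/= mf lf]; split=> //.
  by rewrite sq; apply: poweR_lty.
rewrite inE; apply/andP; split; rewrite inE//=; rewrite /finite_norm.
by apply: (@lty_poweRy _ _ 2) => //; rewrite -sq.
Qed.


Lemma Lfun2_lin (k : R) (f g : T -> R) : f \in L2 -> g \in L2 ->
  (fun x => k * f x + g x) \in L2.
Proof.
by move=> fL gL; have [_ h] := Lfun_submod_closed mu (lee1n 2); exact: h.
Qed.

(** A subsequence [w] with increments of square norm at most [2^-(k+1) / 4^k] makes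
    [sum_k 4^k (w_{k+1} - w_k)^2] integrable, hence finite almost everywhere;
    there the increments are at most a constant times [2^-k], so that [w] converges
    pointwise.  Fatou's lemma transfers the Cauchy bound to the limit. *)
Lemma riesz_fischer (u : nat -> T -> R) :
  (forall n, u n \in L2) ->
  (forall e : R, 0 < e -> exists N, forall m n, (N <= m)%N -> (N <= n)%N ->
    (\int[mu]_x ((u m x - u n x) ^+ 2)%:E <= e%:E)%E) ->
  exists2 v, v \in L2 & forall e : R, 0 < e -> exists N, forall n, (N <= n)%N ->
    (\int[mu]_x ((u n x - v x) ^+ 2)%:E <= e%:E)%E.
Proof.
move=> uL2 u_cauchy.
have mu_ n : measurable_fun setT (u n) by have /Lfun2P[] := uL2 n.
pose eps k : R := 1 / (2 ^ (k + 1))%:R / 4 ^+ k.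
have eps0 k : 0 < eps k.
  by rewrite /eps !divr_gt0// ?ltr0n ?expn_gt0// exprn_gt0.
have [N NP] := choice (fun k => u_cauchy (eps k) (eps0 k)).
pose t := fix t k := if k is k'.+1 then maxn (t k').+1 (N k) else N 0%N.
have Nt k : (N k <= t k)%N by case: k => //= k; exact: leq_maxr.
have tS k : (t k < t k.+1)%N by rewrite /= leq_maxl.
have t_ge k : (k <= t k)%N.
  by elim: k => // k ih; exact: leq_ltn_trans ih (tS k).
pose w k := u (t k).
have mw k : measurable_fun setT (w k) by exact: mu_.
have w_int k : (\int[mu]_x ((w k.+1 x - w k x) ^+ 2)%:E <= (eps k)%:E)%E.
  by apply: NP => //; rewrite (leq_trans (Nt k))// ltnW.
pose G x := (\sum_(0 <= k <oo) (4 ^+ k * (w k.+1 x - w k x) ^+ 2)%:E)%E.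
have msq (f g : T -> R) : measurable_fun setT f -> measurable_fun setT g ->
    measurable_fun setT (fun x => ((f x - g x) ^+ 2)%:E).
  move=> mf mg; apply/measurable_EFinP; apply: measurable_funX.
  exact: measurable_funB.
have mG k : measurable_fun setT
    (fun x => (4 ^+ k * (w k.+1 x - w k x) ^+ 2)%:E).
  under eq_fun do rewrite EFinM.
  by apply: emeasurable_funM; [exact: measurable_cst|apply: msq].
have G_ge0 k x : (0 <= (4 ^+ k * (w k.+1 x - w k x) ^+ 2)%:E)%E.
  by rewrite lee_fin mulr_ge0 ?sqr_ge0// exprn_ge0.
have G_fin : mu.-integrable setT G.
  apply/integrableP; split.
    by apply: ge0_emeasurable_sum => [k x _ _|k _]; [exact: G_ge0|exact: mG].
  under eq_integral do rewrite gee0_abs ?nneseries_ge0//.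
  rewrite integral_nneseries//.
  apply: (@le_lt_trans _ _ (\sum_(0 <= k <oo) (1 / (2 ^ (k + 1))%:R : R)%:E)%E).
    apply: lee_nneseries => k _; first by move=> _; exact: integral_ge0.
    under eq_integral do rewrite EFinM.
    rewrite ge0_integralZl_EFin ?exprn_ge0//; last 2 first.
    - by move=> x _; rewrite lee_fin sqr_ge0.
    - by apply: msq.
    rewrite [leRHS](_ : _ = (4 ^+ k)%:E * (eps k)%:E)%E; last first.
      by rewrite -EFinM /eps [in RHS]mulrC divfK ?gt_eqF ?exprn_gt0.
    by apply: lee_wpmul2l => //; rewrite lee_fin exprn_ge0.
  rewrite (cvg_lim _ (@cvg_geometric_eseries_half _ 1 0%N))//.
  by rewrite ltry.
have w_cvg : \forall x \ae mu, cvgn (fun k => w k x).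
  move: (integrable_ae measurableT G_fin); apply: filterS => x /(_ I) Gx.
  pose M := fine (G x).
  have term_le k : 4 ^+ k * (w k.+1 x - w k x) ^+ 2 <= M.
    rewrite -lee_fin /M fineK//.
    apply: le_trans (nneseries_lim_ge k.+1 _); last by move=> *; exact: G_ge0.
    by rewrite big_nat_recr//= leeDr// sume_ge0.
  apply: (@cvg_geometric_increments _ (Num.sqrt M)) => k.
  have p2 : 0 < 2 ^+ k :> R by rewrite exprn_gt0.
  rewrite ler_pdivlMr// -sqrtr_sqr -[X in _ * X](ger0_norm (ltW p2)) -sqrtr_sqr.
  rewrite -sqrtrM ?sqr_ge0// ler_wsqrtr//.
  by rewrite mulrC -exprM mulnC exprM (_ : 2 ^+ 2 = 4) ?term_le//; ring.
(* The upper limit is measurable everywhere and agrees with the limit wherever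
   [w] converges. *)
pose v x := fine (limn_esup (fun k => (w k x)%:E)).
have mv : measurable_fun setT v.
  apply: measurableT_comp => //; apply: measurable_fun_limn_esup => k.
  exact/measurable_EFinP.
have wv : \forall x \ae mu, (fun k => w k x) @ \oo --> v x.
  move: w_cvg; apply: filterS => x cx.
  have c : (fun k => (w k x)%:E) @ \oo --> (limn (fun k => w k x))%:E.
    by apply: cvg_EFin; [exact: nearW|exact: cx].
  by rewrite /v (cvg_limn_einf_sup c).2.
have tail (e : R) : 0 < e -> exists N, forall n, (N <= n)%N ->
    (\int[mu]_x ((u n x - v x) ^+ 2)%:E <= e%:E)%E.
  move=> e0; have [K KP] := u_cauchy _ e0; exists K => n Kn.
  apply: (@le_trans _ _
    (limn_einf (fun k => \int[mu]_x ((u n x - w k x) ^+ 2)%:E)%E)).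
    apply: le_trans (fatou _ _ _ _) => //; last 2 first.
    - by move=> k; exact: msq.
    - by move=> k x _; rewrite lee_fin sqr_ge0.
    rewrite le_eqVlt; apply/orP; left; apply/eqP; apply: ae_eq_integral => //.
    - exact: msq.
    - rewrite /limn_einf; apply: measurableT_comp => //.
      apply: measurable_fun_limn_esup => k; apply: measurableT_comp => //.
      exact: msq.
    move: wv; apply: filterS => x cx _.
    apply/esym; apply: (cvg_limn_einf_sup _).1.
    apply: cvg_EFin; first exact: nearW.
    rewrite /comp/= expr2; under eq_cvg do rewrite expr2.
    by apply: cvgM; (apply: cvgB; [exact: cvg_cst|exact: cx]).
  apply: (@limn_einf_le _ _ K) => k Kk; apply: KP => //.
  exact: leq_trans Kk (t_ge k).
exists v => //; apply/Lfun2P; split=> //.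
have [K /(_ K (leqnn K)) KP] := tail 1 ltr01.
have uv : (u K \- v) \in L2.
  apply/Lfun2P; split; first exact: measurable_funB.
  by apply: le_lt_trans KP _; rewrite ltry.
have /Lfun2P[_] := Lfun2_lin (-1) uv (uL2 K).
by under eq_integral do rewrite mulN1r opprB subrK.
Qed.

Lemma Lfun2_integrableM (f g : T -> R) : f \in L2 -> g \in L2 ->
  mu.-integrable setT (EFin \o (fun x => f x * g x)).
Proof. by move=> fL gL; apply/Lfun1_integrable; exact: Lfun2_mul_Lfun1. Qed.

Local Notation E := (LfunType mu (lee1n 2)).

Let ip (f g : E) : R := \int[mu]_x (f x * g x).

Let L2_semi_hilbert : is_semi_hilbert ip.
Proof.
have iM (f g : E) := Lfun2_integrableM (LfunP f) (LfunP g).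
have ip_sq (f : E) : (ip f f)%:E = (\int[mu]_x (f x ^+ 2)%:E)%E.
  rewrite /ip /Rintegral fineK; last exact: integrable_fin_num (iM f f).
  by apply: eq_integral => x _; rewrite expr2.
split.
- by move=> f g; apply: eq_Rintegral => x _; rewrite mulrC.
- move=> f g h; rewrite /ip -RintegralD//.
  by apply: eq_Rintegral => x _; rewrite /= mulrDl.
- move=> k f g; rewrite /ip -RintegralZl//.
  by apply: eq_Rintegral => x _; rewrite /= mulrA.
- by move=> f; apply: Rintegral_ge0 => x _; rewrite -expr2 sqr_ge0.
move=> u u_cauchy.
have [|e e0|v vL uv] := @riesz_fischer (fun n => u n : T -> R).
- by move=> n; exact: LfunP.
- have [N NP] := u_cauchy e e0; exists N => m n Nm Nn.
  by have := NP m n Nm Nn; rewrite -lee_fin ip_sq.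
exists (Lfun_Sub (lee1n 2) vL); apply/cvgr0Pnorm_le => e e0.
have [N NP] := uv e e0; exists N => // n /= Nn.
rewrite -lee_fin ger0_norm; last first.
  by apply: Rintegral_ge0 => x _; rewrite -expr2 sqr_ge0.
by rewrite ip_sq; exact: NP.
Qed.

Theorem Lfun2_weak_compact (g : nat -> T -> R) (K : R) :
  (forall n, g n \in L2) -> (forall n, \int[mu]_x (g n x ^+ 2) <= K) ->
  exists2 s : nat -> nat, {homo s : m n / (m < n)%N} &
    exists2 p, p \in L2 & forall h, h \in L2 ->
      (fun n => \int[mu]_x (g (s n) x * h x)) @ \oo --> \int[mu]_x (p x * h x).
Proof.
move=> gL gK.
have [|s s_homo [p sp]] := hilbert_weak_compact L2_semi_hilbert
  (g := fun n => Lfun_Sub (lee1n 2) (gL n)) (K := K).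
  by move=> n; exact: gK.
exists s => //; exists p => [|h hL]; first exact: LfunP.
exact: (sp (Lfun_Sub _ hL)).
Qed.

End riesz_fischer.

(** * The complex space L^2(R^d) *)

Section complex_L2.
Context {R : realType} {d : nat}.
Local Open Scope complex_scope.
Local Notation V := 'rV[R]_d.
Local Notation C := R[i].
Local Notation mu := (lebesgue_Rn R d).
Local Notation L2 := (@Lfun _ V R mu 2%:E).
Local Notation Re := complex.Re.
Local Notation Im := complex.Im.
Implicit Types (f g : V -> C).

Lemma normc_sq (z : C) : normc z ^+ 2 = Re z ^+ 2 + Im z ^+ 2.
Proof. by case: z => x y /=; rewrite sqr_sqrtr// addr_ge0 ?sqr_ge0. Qed.

Lemma normc_ge0 (z : C) : 0 <= normc z.
Proof. by case: z => x y; exact: sqrtr_ge0. Qed.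

Lemma eL2norm_sq f : ((eL2norm f) `^ 2 = \int[mu]_x (normc (f x) ^+ 2)%:E)%E.
Proof.
rewrite /eL2norm powR_Lnorm//; apply: eq_integral => x _ /=.
by rewrite powR_mulrn// ger0_norm ?normc_ge0.
Qed.

Lemma inL2P f : inL2 f <->
  (fun x => Re (f x)) \in L2 /\ (fun x => Im (f x)) \in L2.
Proof.
have split_sq : measurable_fun setT (fun x => Re (f x)) ->
    measurable_fun setT (fun x => Im (f x)) ->
    (\int[mu]_x (normc (f x) ^+ 2)%:E =
     \int[mu]_x (Re (f x) ^+ 2)%:E + \int[mu]_x (Im (f x) ^+ 2)%:E)%E.
  move=> mR mI; rewrite -ge0_integralD//=; last 4 first.
  - by move=> x _; rewrite lee_fin sqr_ge0.
  - by apply/measurable_EFinP; exact: measurable_funX.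
  - by move=> x _; rewrite lee_fin sqr_ge0.
  - by apply/measurable_EFinP; exact: measurable_funX.
  by apply: eq_integral => x _; rewrite -EFinD normc_sq.
split=> [[[mR mI] ff]|[/Lfun2P[mR fR] /Lfun2P[mI fI]]].
  have : (\int[mu]_x (normc (f x) ^+ 2)%:E < +oo)%E.
    by rewrite -eL2norm_sq poweR_lty.
  rewrite split_sq// => h; split; apply/Lfun2P; split=> //;
    apply: le_lt_trans h; [rewrite leeDl//|rewrite leeDr//];
    by apply: integral_ge0 => x _; rewrite lee_fin sqr_ge0.
split; first by [].
apply: (@lty_poweRy _ _ 2) => //; rewrite eL2norm_sq split_sq//.
exact: lte_add_pinfty.
Qed.

Lemma inL2_lin (k : C) f g : inL2 f -> inL2 g ->
  inL2 (fun x => k * f x + g x).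
Proof.
move=> /inL2P[fR fI] /inL2P[gR gI]; apply/inL2P; split.
  rewrite (_ : (fun x => _) =
      (fun x => Re k * Re (f x) + (- Im k * Im (f x) + Re (g x)))).
    by apply: Lfun2_lin => //; exact: Lfun2_lin.
  by apply/funext => x; case: k (f x) (g x) => ? ? [? ?] [? ?] /=; ring.
rewrite (_ : (fun x => _) =
    (fun x => Re k * Im (f x) + (Im k * Re (f x) + Im (g x)))).
  by apply: Lfun2_lin => //; exact: Lfun2_lin.
by apply/funext => x; case: k (f x) (g x) => ? ? [? ?] [? ?] /=; ring.
Qed.

Lemma L2norm_ge0 f : 0 <= L2norm f.
Proof. by rewrite fine_ge0// Lnorm_ge0. Qed.

Lemma L2norm_sq f : inL2 f -> L2norm f ^+ 2 = \int[mu]_x (normc (f x) ^+ 2).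
Proof.
move=> [_ ff]; have fin : eL2norm f \is a fin_num.
  by rewrite ge0_fin_numE ?Lnorm_ge0.
rewrite /Rintegral -eL2norm_sq -powR_mulrn ?L2norm_ge0//.
by rewrite -[in RHS](fineK fin) poweR_EFin.
Qed.

Lemma integrable_normc_sq f : inL2 f ->
  mu.-integrable setT (EFin \o (fun x => normc (f x) ^+ 2)).
Proof.
move=> /inL2P[fR fI].
rewrite (_ : _ \o _ =
    (EFin \o (fun x => Re (f x) * Re (f x))) \+
    (EFin \o (fun x => Im (f x) * Im (f x)))).
  by apply: integrableD => //; exact: Lfun2_integrableM.
by apply/funext => x /=; rewrite normc_sq !expr2.
Qed.

Lemma integrable_Re_inner f g : inL2 f -> inL2 g ->
  mu.-integrable setT (EFin \o (fun x => Re (f x * (g x)^*))).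
Proof.
move=> /inL2P[fR fI] /inL2P[gR gI].
rewrite (_ : _ \o _ =
    (EFin \o (fun x => Re (f x) * Re (g x))) \+
    (EFin \o (fun x => Im (f x) * Im (g x)))).
  by apply: integrableD => //; exact: Lfun2_integrableM.
apply/funext => x /=; rewrite -EFinD; congr EFin.
by case: (f x) (g x) => ? ? [? ?] /=; ring.
Qed.

Lemma integrable_Im_inner f g : inL2 f -> inL2 g ->
  mu.-integrable setT (EFin \o (fun x => Im (f x * (g x)^*))).
Proof.
move=> /inL2P[fR fI] /inL2P[gR gI].
have := integrableB measurableT (Lfun2_integrableM fI gR)
  (Lfun2_integrableM fR gI).
apply: eq_integrable => // x _; rewrite /= -EFinB; congr EFin.
by case: (f x) (g x) => ? ? [? ?] /=; ring.
Qed.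

(** One expansion for three purposes: the scalar [k = s * conj <f, g>] gives
    Cauchy-Schwarz, [k = -1] the norm of a difference, and [k = 1] and [k = -i]
    recover the inner product from the norm. *)
Lemma L2norm_sqD (k : C) f g : inL2 f -> inL2 g ->
  L2norm (fun x => k * f x + g x) ^+ 2 =
  normc k ^+ 2 * L2norm f ^+ 2 + 2 * Re (k * inner f g) + L2norm g ^+ 2.
Proof.
move=> fL gL; have kL := inL2_lin k fL gL.
have iR := integrable_Re_inner fL gL; have iI := integrable_Im_inner fL gL.
have iff := integrable_normc_sq fL; have igg := integrable_normc_sq gL.
rewrite !L2norm_sq//.
have -> : Re (k * inner f g) = Re k * \int[mu]_x Re (f x * (g x)^*)
    - Im k * \int[mu]_x Im (f x * (g x)^*).
  by rewrite /inner /cintegral; case: k {kL}.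
have iZ (a : R) (F : V -> R) : mu.-integrable setT (EFin \o F) ->
    mu.-integrable setT (EFin \o (fun x => a * F x)).
  by move=> /(integrableZl measurableT a).
have iD (F G : V -> R) : mu.-integrable setT (EFin \o F) ->
    mu.-integrable setT (EFin \o G) ->
    mu.-integrable setT (EFin \o (fun x => F x + G x)).
  by move=> iF iG; exact: (integrableD measurableT iF iG).
pose a := normc k ^+ 2; pose p := 2 * Re k; pose q := - (2 * Im k).
rewrite (@eq_Rintegral _ _ _ _ _ (fun x => a * normc (f x) ^+ 2 +
  (p * Re (f x * (g x)^*) + (q * Im (f x * (g x)^*) + normc (g x) ^+ 2)))).
  rewrite RintegralD//;
    [|exact: iZ|by apply: (iD _ _ _ (iD _ _ _ _)); do ?exact: iZ].
  rewrite RintegralD//; [|exact: iZ|by apply: (iD) => //; exact: iZ].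
  rewrite RintegralD//; [|exact: iZ].
  by rewrite !RintegralZl// /a /p /q; ring.
move=> x _; rewrite /a /p /q !normc_sq.
by case: k (f x) (g x) {kL a p q} => ? ? [? ?] [? ?] /=; ring.
Qed.

Lemma eL2normE f : inL2 f -> eL2norm f = (L2norm f)%:E.
Proof. by move=> [_ ff]; rewrite /L2norm fineK// ge0_fin_numE// Lnorm_ge0. Qed.

Lemma normc_inner_le f g : inL2 f -> inL2 g ->
  normc (inner f g) <= L2norm f * L2norm g.
Proof.
move=> fL gL; set z := inner f g; have z0 := normc_ge0 z.
have F0 := L2norm_ge0 f; have G0 := L2norm_ge0 g.
suff : (normc z ^+ 2) ^+ 2 <= L2norm g ^+ 2 * (normc z ^+ 2 * L2norm f ^+ 2).
  have [->|zn0] := eqVneq (normc z) 0; first by rewrite mulr_ge0.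
  have zp : 0 < normc z ^+ 2 by rewrite exprn_gt0// lt_def zn0.
  rewrite [leLHS]expr2 [leRHS]mulrCA ler_pM2l// => h.
  by rewrite -(@ler_pXn2r _ 2)// ?nnegrE ?mulr_ge0// exprMn mulrC.
apply: quadratic_ge0 => [|s]; first by rewrite mulr_ge0// sqr_ge0.
have := sqr_ge0 (L2norm (fun x => (s%:C * z^*) * f x + g x)).
rewrite L2norm_sqD// -/z.
have -> : Re (s%:C * z^* * z) = s * normc z ^+ 2.
  by rewrite normc_sq; case: z {z0} => x y /=; ring.
have -> : normc (s%:C * z^*) ^+ 2 = s ^+ 2 * normc z ^+ 2.
  by rewrite !normc_sq; case: z {z0} => x y /=; ring.
move=> h; apply: le_trans h _; rewrite le_eqVlt; apply/orP; left.
by apply/eqP; ring.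
Qed.

Lemma eq_L2norm f g : (forall x, normc (f x) = normc (g x)) ->
  L2norm f = L2norm g.
Proof.
move=> fg; rewrite /L2norm /eL2norm; congr (fine (Lnorm _ _ _)).
by apply/funext => x /=; rewrite fg.
Qed.

Lemma L2norm_sqB f g : inL2 f -> inL2 g ->
  L2norm (fun x => f x - g x) ^+ 2 =
  L2norm f ^+ 2 - 2 * Re (inner f g) + L2norm g ^+ 2.
Proof.
move=> fL gL; rewrite (@eq_L2norm _ (fun x => (-1) * f x + g x)); last first.
  by move=> x; rewrite mulN1r -normcN opprB addrC.
rewrite L2norm_sqD// normc_sq /= oppr0 expr0n /= addr0 sqrrN expr1n mul1r mul0r.
by rewrite subr0 mulN1r mulrN.
Qed.

Lemma inner_self f : inL2 f -> Re (inner f f) = L2norm f ^+ 2.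
Proof.
move=> fL; rewrite L2norm_sq//=; apply: eq_Rintegral => x _.
by rewrite normc_sq; case: (f x) => ? ? /=; ring.
Qed.

Lemma eqL2_L2norm f g : inL2 f -> inL2 g -> eqL2 f g -> L2norm f = L2norm g.
Proof.
move=> fL gL fg; apply/eqP.
rewrite -(@eqrXn2 _ 2)// ?L2norm_ge0// !L2norm_sq//; apply/eqP.
have mf (h : V -> C) : inL2 h ->
    measurable_fun setT (fun x => (normc (h x) ^+ 2)%:E).
  by move=> hL; have /integrableP[] := integrable_normc_sq hL.
rewrite /Rintegral; congr fine; apply: ae_eq_integral => //; [exact: mf..|].
by move: fg; apply: filterS => x -> .
Qed.

Lemma inL2_sub f g : inL2 f -> inL2 g -> inL2 (fun x => f x - g x).
Proof.
move=> fL gL; rewrite (_ : (fun x => _) = (fun x => (-1) * g x + f x)).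
  exact: inL2_lin.
by apply/funext => x; rewrite mulN1r addrC.
Qed.

Lemma inL2_zero : inL2 (fun _ : V => 0 : C) /\ L2norm (fun _ : V => 0 : C) = 0.
Proof.
have z : eL2norm (fun _ : V => 0 : C) = 0%E.
  rewrite /eL2norm -(@Lnorm0 _ _ _ mu 2%:E)//; congr (Lnorm _ _ _).
  by apply/funext => x /=; rewrite expr0n addr0 sqrtr0.
by split; [split=> //; rewrite z|rewrite /L2norm z].
Qed.

Lemma normc_le_ReIm (z : C) : normc z <= `|Re z| + `|Im z|.
Proof.
rewrite -(@ler_pXn2r _ 2)// ?nnegrE ?normc_ge0 ?addr_ge0//.
rewrite normc_sq -(real_normK (num_real (Re z))).
rewrite -(real_normK (num_real (Im z))).
have := normr_ge0 (Re z); have := normr_ge0 (Im z); move: `|Re z| `|Im z|.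
by move=> x y x0 y0; nra.
Qed.

Lemma inner_ReImE f g : inL2 f -> inL2 g ->
  Re (inner f g) = \int[mu]_x (Re (f x) * Re (g x)) +
                   \int[mu]_x (Im (f x) * Im (g x)) /\
  Im (inner f g) = \int[mu]_x (Im (f x) * Re (g x)) -
                   \int[mu]_x (Re (f x) * Im (g x)).
Proof.
move=> /inL2P[fR fI] /inL2P[gR gI]; split.
  rewrite -RintegralD//; [|exact: Lfun2_integrableM..].
  apply: eq_Rintegral => x _; by case: (f x) (g x) => ? ? [? ?] /=; ring.
rewrite -RintegralB//; [|exact: Lfun2_integrableM..].
apply: eq_Rintegral => x _; by case: (f x) (g x) => ? ? [? ?] /=; ring.
Qed.

Lemma normc_innerC f g : inL2 f -> inL2 g ->
  normc (inner f g) = normc (inner g f).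
Proof.
move=> fL gL.
have [fR fI] := inner_ReImE fL gL; have [gR gI] := inner_ReImE gL fL.
apply/eqP; rewrite -(@eqrXn2 _ 2)// ?normc_ge0// !normc_sq fR fI gR gI.
apply/eqP.
have C1 (F G : V -> R) : \int[mu]_x (F x * G x) = \int[mu]_x (G x * F x).
  by apply: eq_Rintegral => x _; rewrite mulrC.
rewrite (C1 (fun x => Re (f x))) (C1 (fun x => Im (f x))).
rewrite (C1 (fun x => Im (f x))) (C1 (fun x => Re (f x))); ring.
Qed.

Lemma normr_Re_le (z : C) : `|Re z| <= normc z.
Proof.
rewrite -(@ler_pXn2r _ 2)// ?nnegrE ?normc_ge0//.
by rewrite real_normK ?num_real// normc_sq lerDl sqr_ge0.
Qed.

(** The real and imaginary parts are bounded in real L^2; extract for the real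
    parts and then, along that subsequence, for the imaginary parts. *)
Theorem L2_weak_compact (g : nat -> V -> C) (A : R) :
  (forall n, inL2 (g n)) -> (forall n, L2norm (g n) <= A) ->
  exists2 s : nat -> nat, {homo s : m n / (m < n)%N} &
    exists2 p, inL2 p & weakly_cvgL2 (g \o s) p.
Proof.
move=> gL gA.
have gR n : (fun x => Re (g n x)) \in L2 by have /inL2P[] := gL n.
have gI n : (fun x => Im (g n x)) \in L2 by have /inL2P[] := gL n.
have sq_le n : L2norm (g n) ^+ 2 <= A ^+ 2.
  by rewrite ler_pXn2r// nnegrE ?L2norm_ge0// (le_trans _ (gA n)) ?L2norm_ge0.
have sq_split n : L2norm (g n) ^+ 2 =
    \int[mu]_x (Re (g n x) ^+ 2) + \int[mu]_x (Im (g n x) ^+ 2).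
  rewrite -inner_self//; have [-> _] := inner_ReImE (gL n) (gL n).
  by congr (_ + _); apply: eq_Rintegral => x _; rewrite expr2.
have ge0 (F : V -> R) : 0 <= \int[mu]_x (F x ^+ 2).
  by apply: Rintegral_ge0 => x _; exact: sqr_ge0.
have [n|s s_homo [a aL sa]] := Lfun2_weak_compact (K := A ^+ 2) gR.
  apply: le_trans (sq_le n); rewrite sq_split lerDl; exact: ge0.
have [n|t t_homo [b bL tb]] :=
    Lfun2_weak_compact (K := A ^+ 2) (g := fun n x => Im (g (s n) x))
      (fun n => gI (s n)).
  apply: le_trans (sq_le (s n)); rewrite sq_split lerDr; exact: ge0.
exists (s \o t); first by move=> m n mn; apply: s_homo; exact: t_homo.
have pL : inL2 (fun x => a x +i* b x) by apply/inL2P.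
exists (fun x => a x +i* b x) => // h hL; have /inL2P[hR hI] := hL.
have sta k : k \in L2 -> (fun n => \int[mu]_x (Re (g (s (t n)) x) * k x))
    @ \oo --> \int[mu]_x (a x * k x).
  move=> kL.
  apply: (@cvg_subseq _ (fun n => \int[mu]_x (Re (g (s n) x) * k x))).
    exact: homo_ltn_ge.
  exact: sa.
set q := inner _ h.
have [qR qI] := inner_ReImE pL hL.
have cR : (fun n => Re (inner (g (s (t n))) h) - Re q) @ \oo --> (0 : R).
  apply/subr_cvg0; rewrite /q qR.
  under eq_cvg do rewrite (inner_ReImE (gL _) hL).1.
  by apply: cvgD; [exact: sta|exact: tb].
have cI : (fun n => Im (inner (g (s (t n))) h) - Im q) @ \oo --> (0 : R).
  apply/subr_cvg0; rewrite /q qI.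
  under eq_cvg do rewrite (inner_ReImE (gL _) hL).2.
  by apply: cvgB; [exact: tb|exact: sta].
apply: (@squeeze_cvgr _ _ _ _ (fun=> 0) (fun n =>
  `|Re (inner (g (s (t n))) h) - Re q| + `|Im (inner (g (s (t n))) h) - Im q|)).
- apply: nearW => n; rewrite normc_ge0 (le_trans (normc_le_ReIm _))//.
- exact: cvg_cst.
- have /cvg_norm nR := cR; have /cvg_norm nI := cI.
  rewrite (_ : 0 = `|0 : R| + `|0 : R|); last by rewrite normr0 addr0.
  by apply: cvgD; [exact: nR|exact: nI].
Qed.

Lemma inL2_invL2 (T : (V -> C) -> V -> C) g : unitaryL2 T -> inL2 g ->
  inL2 (invL2 T g) /\ eqL2 (T (invL2 T g)) g.
Proof.
move=> [_ _ _ Tsurj] gL; have [f fL Tf] := Tsurj g gL.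
exact: (@xgetPex _ (fun=> 0) [set f | inL2 f /\ eqL2 (T f) g]
  (ex_intro _ f (conj fL Tf))).
Qed.

(** An operator that is unitary in this sense need not commute with subtraction
    pointwise; the identity holds since norms do not see null sets. *)
Lemma unitaryL2_L2normB (T : (V -> C) -> V -> C) f g h : unitaryL2 T ->
  inL2 f -> inL2 g -> inL2 h -> eqL2 (T g) h ->
  L2norm (fun x => f x - g x) = L2norm (fun x => T f x - h x).
Proof.
move=> [TL Tlin Tnorm _] fL gL hL Tgh.
pose k : V -> C := fun x => (-1) * g x + f x.
have kL : inL2 k by exact: inL2_lin.
rewrite (_ : (fun x => f x - g x) = k); last first.
  by apply/funext => x; rewrite /k mulN1r addrC.
rewrite -(Tnorm _ kL); apply: eqL2_L2norm; first exact: TL.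
  by apply: inL2_sub => //; exact: TL.
move: (Tlin (-1) g f gL fL) Tgh => E1 E2.
apply: filterS2 E1 E2 => x e1 e2 _.
by rewrite e1// e2// mulN1r addrC.
Qed.

End complex_L2.

(** * Affine change of variables for the Lebesgue measure of R^n *)

Section affine_change_of_variables.
Context {R : realType}.

Lemma measurable_affine (l b : R) :
  measurable_fun setT
    (fun t : measurableTypeR R => l * t + b : measurableTypeR R).
Proof. by apply: measurable_funD => //; exact: measurable_funM. Qed.

(** By uniqueness of the Lebesgue measure: [l] times the image of the measure
    under [t |-> l * t + b] gives each interval its length. *)
Lemma lebesgue_measure_affine (l b : R) (A : set (measurableTypeR R)) :
  0 < l -> measurable A ->
  (lebesgue_measure ((fun t : R => l * t + b)%R @^-1` A) =
   (l^-1)%:E * lebesgue_measure A)%E.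
Proof.
move=> l0 mA; pose phi (t : measurableTypeR R) : measurableTypeR R := l * t + b.
have mphi : measurable_fun setT phi by exact: measurable_affine.
pose m := mscale (NngNum (ltW l0)) (pushforward (@lebesgue_measure R) phi).
rewrite [in RHS](@lebesgue_measure_unique R (m mphi) _ A mA).
  by rewrite /m /mscale /= muleA -EFinM mulVf ?mul1e// gt_eqF.
move=> X /ocitvP[->|[[x y] /= xy ->]]; first by rewrite !measure0.
rewrite /m /mscale/= /pushforward.
have -> : phi @^-1` `]x, y] = [set` `](x - b) / l, (y - b) / l]].
  apply/seteqP; split=> t /=; rewrite !in_itv/= ltr_pdivrMr// ler_pdivlMr//;
    by rewrite /phi ltrBlDr lerBrDr mulrC.
rewrite !lebesgue_measure_itv/= !lte_fin.
rewrite ltr_pM2r ?invr_gt0// ltrD2r; case: ifPn => _; last by rewrite mule0.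
rewrite -!EFinB -EFinM; congr EFin; field; exact: lt0r_neq0.
Qed.

Lemma ge0_integral_affine (l b : R) (F : measurableTypeR R -> \bar R) :
  0 < l -> measurable_fun setT F -> (forall t, 0 <= F t)%E ->
  (\int[lebesgue_measure]_t F (l * t + b)%R =
   (l^-1)%:E * \int[lebesgue_measure]_t F t)%E.
Proof.
move=> l0 mF F0.
pose phi (t : measurableTypeR R) : measurableTypeR R := l * t + b.
have mphi : measurable_fun setT phi by exact: measurable_affine.
have l'0 : 0 <= l^-1 by rewrite invr_ge0 ltW.
have := ge0_integral_mscale (@lebesgue_measure R) measurableT (NngNum l'0) mF.
move=> <-//.
rewrite -[LHS](ge0_integral_pushforward mphi (@lebesgue_measure R)
  measurableT mF)//.
apply: eq_measure_integral => A mA _.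
by rewrite /mscale/= /pushforward; exact: lebesgue_measure_affine.
Qed.

Lemma integral_lebesgue_RnS n (F : 'rV[R]_n.+1 -> \bar R) :
  measurable_fun setT F -> (forall x, 0 <= F x)%E ->
  (\int[lebesgue_Rn R n.+1]_x F x =
   \int[lebesgue_measure]_t \int[lebesgue_Rn R n]_v F (cons_rV (t, v)))%E.
Proof.
move=> mF F0; have mc := @measurable_cons_rV R n.
rewrite [LHS](_ : _ =
    \int[lebesgue_measure \x lebesgue_Rn R n]_p F (cons_rV p))%E.
  by rewrite fubini_tonelli1//; exact: measurableT_comp.
by rewrite -[RHS](ge0_integral_pushforward mc
  (lebesgue_measure \x lebesgue_Rn R n)%E measurableT mF).
Qed.

Lemma measurable_affine_rV n (l : R) (x0 : 'rV[R]_n) :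
  measurable_fun setT (fun x : 'rV[R]_n => l *: x + x0).
Proof.
apply: measurable_fun_rVP => i; under eq_fun do rewrite !mxE.
apply: measurable_funD => //; apply: measurable_funM => //.
exact: measurable_coor.
Qed.

(** The map acts on the first coordinate and on the remaining ones separately,
    so that Tonelli reduces dimension [n.+1] to dimensions [n] and [1]. *)
Lemma integral_lebesgue_Rn_affine n (l : R) (x0 : 'rV[R]_n)
    (F : 'rV[R]_n -> \bar R) :
  0 < l -> measurable_fun setT F -> (forall x, 0 <= F x)%E ->
  (\int[lebesgue_Rn R n]_x F (l *: x + x0)%R =
   (l ^- n)%:E * \int[lebesgue_Rn R n]_x F x)%E.
Proof.
move=> l0; elim: n x0 F => [|n IH] x0 F mF F0.
  rewrite expr0 invr1 mul1e; apply: eq_integral => x _.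
  by rewrite [l *: x + x0](_ : _ = x)//; apply/rowP => -[].
have maff := measurable_affine_rV l x0.
rewrite integral_lebesgue_RnS//; last exact: measurableT_comp.
pose H t := (\int[lebesgue_Rn R n]_v F (cons_rV (t, v)))%E.
have mFc := measurableT_comp mF (@measurable_cons_rV R n).
have mH : measurable_fun setT H.
  exact: (measurable_fun_fubini_tonelli_F (m2 := lebesgue_Rn R n) _ mFc
    (fun p => F0 _)).
have H0 t : (0 <= H t)%E by exact: integral_ge0.
pose x0' : 'rV[R]_n := \row_i x0 ord0 (lift ord0 i).
transitivity (\int[lebesgue_measure]_t
    ((l ^- n)%:E * H (l * t + x0 ord0 ord0)%R))%E.
  apply: eq_integral => t _; rewrite /H.
  rewrite -(IH x0' (fun v => F (cons_rV (l * t + x0 ord0 ord0, v))))//.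
    2: exact: (measurableT_comp mFc
      (pair1_measurable (l * t + x0 ord0 ord0 : measurableTypeR R))).
  apply: eq_integral => v _; congr (F _); apply/rowP => i.
  case: (unliftP ord0 i) => [j|] ->; rewrite [LHS]mxE [X in X + _]mxE.
    by rewrite !cons_rVS /= !mxE.
  by rewrite !cons_rV0.
rewrite ge0_integralZl_EFin//; last 2 first.
- exact: (measurableT_comp mH (measurable_affine l (x0 ord0 ord0))).
- by rewrite invr_ge0 exprn_ge0// ltW.
rewrite (ge0_integral_affine _ l0 mH)// muleA -EFinM -invfM -exprSr.
by rewrite (integral_lebesgue_RnS mF).
Qed.

End affine_change_of_variables.

(** * Dilations and time-frequency shifts are isometries *)

Section time_frequency_isometries.
Context {R : realType} {d : nat}.
Local Open Scope complex_scope.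
Local Notation V := 'rV[R]_d.
Local Notation C := R[i].
Local Notation mu := (lebesgue_Rn R d).
Local Notation Re := complex.Re.
Local Notation Im := complex.Im.
Implicit Types (f g : V -> C).

Lemma cmeasurable_normc_sq f : cmeasurable f ->
  measurable_fun setT (fun x => (normc (f x) ^+ 2)%:E).
Proof.
move=> [mR mI]; apply/measurable_EFinP; under eq_fun do rewrite normc_sq.
by apply: measurable_funD; exact: measurable_funX.
Qed.

Lemma cmeasurableM f g : cmeasurable f -> cmeasurable g ->
  cmeasurable (fun x => f x * g x).
Proof.
move=> [fR fI] [gR gI]; split.
  rewrite (_ : (fun x => _) =
      (fun x => Re (f x) * Re (g x) - Im (f x) * Im (g x))).
    by apply: measurable_funB; exact: measurable_funM.
  by apply/funext => x; case: (f x) (g x) => ? ? [].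
rewrite (_ : (fun x => _) =
    (fun x => Re (f x) * Im (g x) + Im (f x) * Re (g x))).
  by apply: measurable_funD; exact: measurable_funM.
by apply/funext => x; case: (f x) (g x) => ? ? [].
Qed.

(** Common form of the four operators: the modulus [l^(d/2)] of the weight
    compensates the Jacobian [l^-d] of the substitution. *)
Lemma weighted_affine_L2 (l : R) (x0 : V) (c f : V -> C) : 0 < l ->
  cmeasurable c -> (forall x, normc (c x) ^+ 2 = l ^+ d) -> inL2 f ->
  inL2 (fun x => c x * f (l *: x + x0)) /\
  L2norm (fun x => c x * f (l *: x + x0)) = L2norm f.
Proof.
move=> l0 mc cl [mf ff]; set Tf := fun x => c x * f _.
have maff := measurable_affine_rV l x0.
have mTf : cmeasurable Tf.
  apply: cmeasurableM => //; case: mf => mR mI.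
  split; first exact: (measurableT_comp mR maff).
  exact: (measurableT_comp mI maff).
have e : eL2norm Tf = eL2norm f.
  have sq : (eL2norm Tf `^ 2 = eL2norm f `^ 2)%E.
    rewrite !eL2norm_sq.
    transitivity (\int[mu]_x
        ((l ^+ d)%:E * (normc (f (l *: x + x0)) ^+ 2)%:E))%E.
      apply: eq_integral => x _; rewrite /Tf -EFinM; congr EFin.
      by rewrite normcM exprMn cl.
    rewrite ge0_integralZl_EFin//; last 3 first.
    - by move=> x _; rewrite lee_fin sqr_ge0.
    - exact: (measurableT_comp (cmeasurable_normc_sq mf) maff).
    - by rewrite exprn_ge0// ltW.
    rewrite (@integral_lebesgue_Rn_affine _ _ _ _
      (fun x => (normc (f x) ^+ 2)%:E))//.
    - by rewrite muleA -EFinM mulfV ?mul1e// expf_neq0// gt_eqF.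
    - exact: cmeasurable_normc_sq.
    - by move=> x; rewrite lee_fin sqr_ge0.
  have h0 h : (0 <= eL2norm (h : V -> C))%E by exact: Lnorm_ge0.
  have := congr1 (fun z => z `^ 2^-1)%E sq.
  by rewrite -!poweRrM divff// !poweRe1.
by split; [split=> //; rewrite e|rewrite /L2norm e].
Qed.


Definition norm_preserving (T : (V -> C) -> V -> C) :=
  forall f, inL2 f -> inL2 (T f) /\ L2norm (T f) = L2norm f.

Lemma normc_expi (t : R) : normc (expi t) = 1.
Proof. by rewrite /expi /= cos2Dsin2 sqrtr1. Qed.

Lemma cmeasurable_expi (h : V -> R) : measurable_fun setT h ->
  cmeasurable (fun x => expi (h x)).
Proof.
move=> mh; split; apply: measurableT_comp mh => //;
  apply: continuous_measurable_fun; [exact: continuous_cos|exact: continuous_sin].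
Qed.

Lemma measurable_dotp (x0 xi : V) :
  measurable_fun setT (fun x : V => dotp (x - x0) xi).
Proof.
apply: measurable_sum => i; apply: measurable_funM => //.
under eq_fun do rewrite !mxE; apply: measurable_funB => //.
exact: measurable_coor.
Qed.

Lemma tf_shift_norm_preserving x0 xi0 : norm_preserving (tf_shift x0 xi0).
Proof.
move=> f fL; rewrite (_ : tf_shift x0 xi0 f =
    fun x => expi (dotp (x - x0) xi0) * f (1 *: x + (- x0))); last first.
  by apply/funext => x; rewrite scale1r.
apply: weighted_affine_L2 => // [|x]; last by rewrite normc_expi !expr1n.
exact: cmeasurable_expi (measurable_dotp _ _).
Qed.

Lemma tf_shift_inv_norm_preserving x0 xi0 :
  norm_preserving (tf_shift_inv x0 xi0).
Proof.
move=> f fL; rewrite (_ : tf_shift_inv x0 xi0 f =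
    fun x => expi (- dotp x xi0) * f (1 *: x + x0)); last first.
  by apply/funext => x; rewrite scale1r.
apply: weighted_affine_L2 => // [|x]; last by rewrite normc_expi !expr1n.
apply: cmeasurable_expi; apply: measurableT_comp => //.
by have := measurable_dotp 0 xi0; under eq_fun do rewrite subr0.
Qed.

(** Squared modulus of the weights of the dilation ([s = -1]) and of its inverse
    ([s = 1]). *)
Lemma normc_powR_half (l : R) (s : R) : 0 < l ->
  normc ((l `^ (s * (d%:R / 2)))%:C) ^+ 2 = (l `^ s) ^+ d.
Proof.
move=> l0; rewrite normc_sq /= expr0n addr0 -!powR_mulrn ?powR_ge0//.
by rewrite -!powRrM; congr (_ `^ _); field.
Qed.

Lemma dilation_norm_preserving (l : R) : 0 < l ->
  norm_preserving (@dilation R d l).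
Proof.
move=> l0 f fL; rewrite (_ : dilation l f =
    fun x => (l `^ (- (d%:R / 2)))%:C * f (l^-1 *: x + 0)); last first.
  by apply/funext => x; rewrite addr0.
apply: weighted_affine_L2 => // [|x]; first by rewrite invr_gt0.
by rewrite -[- _]mulN1r normc_powR_half// powR_inv1 ?ltW.
Qed.

Lemma dilation_inv_norm_preserving (l : R) : 0 < l ->
  norm_preserving (@dilation_inv R d l).
Proof.
move=> l0 f fL; rewrite (_ : dilation_inv l f =
    fun x => (l `^ (d%:R / 2))%:C * f (l *: x + 0)); last first.
  by apply/funext => x; rewrite addr0.
apply: weighted_affine_L2 => // x.
by rewrite -[d%:R / 2]mul1r normc_powR_half// powRr1 ?ltW.
Qed.

(** Polarization: by [L2norm_sqD] the norm of [k f + g] determines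
    [Re (k <f, g>)]; take [k = 1] and [k = -i]. *)
Lemma inner_norm_preserving (T : (V -> C) -> V -> C) f g :
  norm_preserving T ->
  (forall (k : C) f g,
    T (fun x => k * f x + g x) = (fun x => k * T f x + T g x)) ->
  inL2 f -> inL2 g -> inner (T f) (T g) = inner f g.
Proof.
move=> Tn Tlin fL gL; have [TfL Tf] := Tn f fL; have [TgL Tg] := Tn g gL.
have polar (k : C) : Re (k * inner (T f) (T g)) = Re (k * inner f g).
  have [_ h] := Tn _ (inL2_lin k fL gL).
  have := congr1 (fun x => x ^+ 2) h; rewrite /= Tlin !L2norm_sqD// Tf Tg.
  by move=> /addIr/addrI/mulfI; apply.
have := polar 1; have := polar (0 -i* 1); rewrite !mul1r.
case: (inner (T f) (T g)) (inner f g) => a b [p q] /=.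
by rewrite !mul0r !mulN1r !opprK !add0r => -> ->.
Qed.

Lemma dotp_ge0 (x : V) : 0 <= dotp x x.
Proof. by apply: sumr_ge0 => i _; rewrite -expr2 sqr_ge0. Qed.

End time_frequency_isometries.

(** * The Gaussian is square integrable *)

Section gaussian.
Context {R : realType}.

Lemma measurable_dotp_self n :
  measurable_fun setT (fun x : 'rV[R]_n => dotp x x).
Proof.
by apply: measurable_sum => i; apply: measurable_funM; exact: measurable_coor.
Qed.

Lemma measurable_expR_dotp n :
  measurable_fun setT (fun x : 'rV[R]_n => (expR (- dotp x x))%:E).
Proof.
apply/measurable_EFinP; apply: measurableT_comp => //.
by apply: measurableT_comp => //; exact: measurable_dotp_self.
Qed.

(** The function [exp (- |x|^2)] is, up to a constant, the square of the Gaussian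
    packet, and it factors over the coordinates. *)
Lemma integral_gauss_Rn n :
  (\int[lebesgue_Rn R n]_x (expR (- dotp x x))%:E = (Num.sqrt pi ^+ n)%:E)%E.
Proof.
have mE k := @measurable_expR_dotp k.
elim: n => [|n IH].
  transitivity (\int[\d_(0%R : 'rV[R]_0)]_x (expR (- dotp x x)%R)%:E)%E => //.
  rewrite integral_dirac//; last exact: mE.
  rewrite diracE in_setT.
  rewrite mul1e [dotp _ _]big1 => [|[]//].
  by rewrite oppr0 expR0 expr0.
rewrite integral_lebesgue_RnS//.
transitivity (\int[@lebesgue_measure R]_t
    ((Num.sqrt pi ^+ n)%:E * (gauss_fun (t : R))%:E))%E.
  apply: eq_integral => t _; rewrite -IH muleC -ge0_integralZl_EFin//;
    [|exact: mE|exact: gauss_fun_ge0].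
  apply: eq_integral => v _; rewrite -EFinM; congr EFin.
  rewrite /gauss_fun -expRD; congr expR.
  rewrite /dotp big_ord_recl cons_rV0 -opprD; congr (- (_ + _)).
  by apply: eq_bigr => i _; rewrite cons_rVS.
rewrite ge0_integralZl_EFin//; last 2 first.
- by move=> t _; rewrite lee_fin gauss_fun_ge0.
- by apply/measurable_EFinP; exact: measurable_gauss_fun.
by rewrite integralT_gauss -EFinM exprSr.
Qed.

Lemma inL2_gaussian d : inL2 (@gaussian R d).
Proof.
apply/inL2P; split; last first.
  apply/Lfun2P; split; first exact: measurable_cst.
  by rewrite integral0_eq// => x _; rewrite /= expr0n.
pose c : R := 2 `^ (- (d%:R / 2)) * pi `^ (- (3 * d%:R / 4)).
have mg : measurable_fun setT (fun x : 'rV[R]_d => complex.Re (gaussian x)).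
  apply: measurable_funM => //; apply: measurableT_comp => //.
  apply: measurableT_comp => //; apply: measurable_funM => //.
  apply: measurable_funX; apply: measurableT_comp; last first.
    exact: measurable_dotp_self.
  by apply: continuous_measurable_fun; exact: sqrt_continuous.
apply/Lfun2P; split=> //.
rewrite (_ : \int[_]_x _ =
    \int[lebesgue_Rn R d]_x ((c ^+ 2)%:E * (expR (- dotp x x))%:E))%E.
  rewrite ge0_integralZl_EFin ?sqr_ge0//; last exact: measurable_expR_dotp.
  by rewrite integral_gauss_Rn -EFinM ltry.
apply: eq_integral => x _; rewrite -EFinM; congr EFin.
rewrite /= -/c exprMn; congr (_ * _); rewrite expr2 -expRD; congr expR.
by rewrite /enorm sqr_sqrtr ?dotp_ge0//; lra.
Qed.

End gaussian.

(** * Concentration and extraction of the profile *)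

Section profile_extraction.
Context {R : realType} {d : nat}.
Local Open Scope complex_scope.
Local Notation V := 'rV[R]_d.
Local Notation C := R[i].
Local Notation mu := (lebesgue_Rn R d).
Local Notation Re := complex.Re.
Local Notation Im := complex.Im.
Implicit Types (f g : V -> C).

Definition tf_dilation (l : R) (x0 xi0 : V) f : V -> C :=
  dilation l (tf_shift x0 xi0 f).
Definition tf_dilation_inv (l : R) (x0 xi0 : V) f : V -> C :=
  tf_shift_inv x0 xi0 (dilation_inv l f).

Lemma tf_dilation_invK l x0 xi0 : 0 < l ->
  cancel (tf_dilation_inv l x0 xi0) (tf_dilation l x0 xi0).
Proof. by move=> l0 f; rewrite /tf_dilation tf_shift_invK dilation_invK. Qed.

Lemma tf_dilation_norm_preserving l x0 xi0 : 0 < l ->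
  norm_preserving (tf_dilation l x0 xi0).
Proof.
move=> l0 f fL; have [tL te] := tf_shift_norm_preserving x0 xi0 fL.
by have [dL de] := dilation_norm_preserving l0 tL; rewrite /tf_dilation de.
Qed.

Lemma tf_dilation_inv_norm_preserving l x0 xi0 : 0 < l ->
  norm_preserving (tf_dilation_inv l x0 xi0).
Proof.
move=> l0 f fL; have [dL de] := dilation_inv_norm_preserving l0 fL.
have [tL te] := tf_shift_inv_norm_preserving x0 xi0 dL.
by rewrite /tf_dilation_inv te.
Qed.

Lemma tf_dilation_lin l x0 xi0 (k : C) f g :
  tf_dilation l x0 xi0 (fun x => k * f x + g x) =
  (fun x => k * tf_dilation l x0 xi0 f x + tf_dilation l x0 xi0 g x).
Proof.
by apply/funext => x; rewrite /tf_dilation /dilation /tf_shift; ring.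
Qed.

Lemma inner_tf_dilation l x0 xi0 f g : 0 < l -> inL2 f -> inL2 g ->
  inner (tf_dilation l x0 xi0 f) (tf_dilation l x0 xi0 g) = inner f g.
Proof.
move=> l0 fL gL; apply: inner_norm_preserving => //.
  exact: tf_dilation_norm_preserving.
exact: tf_dilation_lin.
Qed.

(** The threshold solves [C0 * B `^ theta * A `^ (1 - theta) = eps] for [B], with an
    extra factor [1/2] that makes the inequality strict: the left-hand side
    is [2^-theta * eps]. *)
Lemma concentration_threshold (C0 A eps theta : R) :
  0 < C0 -> 0 < A -> 0 < eps -> 0 < theta < 1 ->
  C0 * (2^-1 * C0 `^ (- theta^-1) * eps *
          (eps / A) `^ ((1 - theta) / theta)) `^ theta * A `^ (1 - theta) < eps.
Proof.
move=> C00 A0 eps0 /andP[t0 t1]; have tn0 : theta != 0 by rewrite gt_eqF.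
have eA0 : 0 < eps / A by rewrite divr_gt0.
rewrite !powRM ?mulr_ge0 ?powR_ge0 ?invr_ge0 ?(ltW eps0) ?(ltW A0)//.
rewrite -!powRrM mulNr mulVf// divfK// powRN powRr1 ?(ltW C00)//.
rewrite [ltLHS](_ : _ = 2^-1 `^ theta * (eps `^ theta * eps `^ (1 - theta)) *
  (A^-1 `^ (1 - theta) * A `^ (1 - theta))); last by field; rewrite gt_eqF.
rewrite -powRM ?invr_ge0 ?(ltW A0)// mulVf ?gt_eqF// powR1 mulr1.
rewrite -powRD; last first.
  by apply/implyP => _; rewrite gt_eqF.
rewrite addrC subrK powRr1 ?(ltW eps0)// gtr_pMl//.
have one : 1 `^ theta = 1 :> R by rewrite powR1.
by rewrite -[ltRHS]one gt0_ltr_powR// ?nnegrE ?invr_ge0// invf_lt1// ltr1n.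
Qed.



(** If all inner products were below the threshold, so would be their supremum,
    and the estimate would contradict [concentration_threshold].  Positivity of
    [A] comes from the same estimate, whose right-hand side vanishes with [N]. *)
Lemma wave_packet_concentration (u : R -> V -> C) (S N : \bar R)
  (C0 A eps theta : R) : 0 < C0 -> 0 < eps -> 0 < theta < 1 ->
  (eps%:E <= S)%E ->
  (S <= C0%:E * wave_packet_sup u `^ theta * N `^ (1 - theta)%R)%E ->
  (0 <= N <= A%:E)%E ->
  0 < A /\ exists (l t : R) (x0 xi0 : V), [/\ 0 < l <= 1, `|t| <= 1 &
    2^-1 * C0 `^ (- theta^-1) * eps * (eps / A) `^ ((1 - theta) / theta) <=
      normc (inner (tf_dilation l x0 xi0 (@gaussian R d)) (u t))].
Proof.
move=> C00 eps0 /[dup] t01 /andP[t0 t1] epsS hest /andP[N0 NA].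
have A0 : 0 < A.
  rewrite ltNge; apply/negP => A0; have NE : N = 0%E.
    by apply/eqP; rewrite eq_le N0 andbT (le_trans NA)// lee_fin.
  move: (le_trans epsS hest); rewrite NE poweR0r ?mule0 ?lee_fin ?leNgt ?eps0//.
  by rewrite subr_eq0 gt_eqF.
split=> //; apply: contrapT => nex.
set B := 2^-1 * _ * _ * _ in nex.
have B0 : 0 <= B by rewrite !mulr_ge0 ?powR_ge0 ?invr_ge0 ?(ltW eps0).
have supB : (wave_packet_sup u <= B%:E)%E.
  apply: ge_ereal_sup => _ [l [t [x0 [xi0 [hl ht ->]]]]].
  rewrite lee_fin leNgt; apply/negP => h; apply: nex.
  by exists l, t, x0, xi0; split=> //; exact: ltW.
have sup0 : (0 <= wave_packet_sup u)%E.
  apply: le_trans (ereal_sup_ubound _); last first.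
    by exists 1, 0, 0, 0; split=> //; rewrite ?ltr01 ?lexx ?normr0 ?ler01.
  by rewrite lee_fin normc_ge0.
have t1' : 0 <= 1 - theta by rewrite subr_ge0 ltW.
have : (eps%:E <= C0%:E * (B `^ theta)%:E * (A `^ (1 - theta))%:E)%E.
  apply: le_trans epsS (le_trans hest _); rewrite -!poweR_EFin.
  apply: lee_pmul; rewrite ?mule_ge0 ?poweR_ge0 ?lee_fin ?(ltW C00)//.
  - apply: lee_wpmul2l; first by rewrite lee_fin ltW.
    by apply: gt0_ler_poweR;
      rewrite ?(ltW t0)// in_itv/= ?leey ?lee_fin ?sup0 ?B0.
  - by apply: gt0_ler_poweR; rewrite // in_itv/= ?leey ?lee_fin ?N0 ?(ltW A0).
by rewrite -!EFinM lee_fin leNgt concentration_threshold.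
Qed.

End profile_extraction.

Theorem lemma1p4 (R : realType) (d : nat) (hd : (1 <= d)%N)
    (c : ('I_d -> nat) -> ('I_d -> nat) -> R) (eps0 : R)
    (heps0 : 0 < eps0 < 1)
    (a : R -> 'rV[R]_d -> 'rV[R]_d -> R) (ha : admissible c eps0 a)
    (U : R -> R -> ('rV[R]_d -> R[i]) -> 'rV[R]_d -> R[i])
    (hU : propagator a U)
    (theta C : R) (htheta : 0 < theta < 1)
    (hest : forall u0 : 'rV[R]_d -> R[i], inL2 u0 ->
      (strichartz_norm (fun t => U t 0%R u0) <=
        C%:E * wave_packet_sup (fun t => U t 0%R u0) `^ theta *
        eL2norm u0 `^ (1 - theta)%R)%E) :
  exists2 c0 : R, 0 < c0 &
    forall (A eps : R) (f : nat -> 'rV[R]_d -> R[i]),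
      0 < eps ->
      (forall n, inL2 (f n)) ->
      (forall n, L2norm (f n) <= A) ->
      (forall n, (eps%:E <= strichartz_norm (fun t => U t 0%R (f n)))%E) ->
      exists sigma : nat -> nat, {homo sigma : m n / (m < n)%N} /\
      exists (lambda t : nat -> R) (x xi : nat -> 'rV[R]_d)
        (phi : 'rV[R]_d -> R[i]),
        [/\ forall n, 0 < lambda n <= 1 /\ -1 <= t n <= 1,
            inL2 phi /\ ~ eqL2 phi (fun=> 0),
            weakly_cvgL2
              (fun n => tf_shift_inv (x n) (xi n)
                 (dilation_inv (lambda n) (U (t n) 0 (f (sigma n))))) phi,
            c0 * eps * (eps / A) `^ ((1 - theta) / theta) <= L2norm phi
          & let w n := invL2 (U (t n) 0)
                 (dilation (lambda n) (tf_shift (x n) (xi n) phi)) in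
            (fun n => L2norm (f (sigma n)) ^+ 2
                      - L2norm (fun y => f (sigma n) y - w n y) ^+ 2
                      - L2norm (w n) ^+ 2) @ \oo --> (0 : R)].
Proof.
have [hun _] := hU; have psiL := inL2_gaussian (R := R) d.
(* The constant of the estimate may be assumed positive. *)
pose C0 := Num.max C 1; have C00 : 0 < C0 by rewrite lt_max ltr01 orbT.
pose k := 2^-1 * C0 `^ (- theta^-1).
have k0 : 0 < k by rewrite mulr_gt0 ?invr_gt0// powR_gt0.
(* [M] bounds the norm of the Gaussian and is positive by construction. *)
pose M := 1 + L2norm (@gaussian R d).
have M0 : 0 < M by rewrite ltr_pwDl// L2norm_ge0.
exists (k / M); first by rewrite divr_gt0.
move=> A eps f eps_gt0 fL fA f_eps.
have conc n : 0 < A /\ exists p : R * R * ('rV[R]_d * 'rV[R]_d),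
    [/\ 0 < p.1.1 <= 1, `|p.1.2| <= 1 &
     k * eps * (eps / A) `^ ((1 - theta) / theta) <=
       normc (inner (tf_dilation p.1.1 p.2.1 p.2.2 (@gaussian R d))
                    (U p.1.2 0 (f n)))].
  have [||A0 [l [t [x0 [xi0 h]]]]] := @wave_packet_concentration R d
    (fun t => U t 0 (f n)) _ (eL2norm (f n)) C0 A eps theta C00 eps_gt0 htheta
    (f_eps n); last first.
  - by split=> //; exists ((l, t), (x0, xi0)).
  - by rewrite Lnorm_ge0/= eL2normE// lee_fin.
  apply: le_trans (hest _ (fL n)) _; apply: lee_wpmul2r; first exact: poweR_ge0.
  apply: lee_wpmul2r; first exact: poweR_ge0.
  by rewrite lee_fin le_max lexx.
have A0 : 0 < A := (conc 0%N).1.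
have /choice[p pP] : forall n, _ := fun n => (conc n).2.
set B := k * eps * _ in pP.
have B0 : 0 < B by rewrite mulr_gt0 ?powR_gt0 ?divr_gt0// mulr_gt0.
pose g n := tf_dilation_inv (p n).1.1 (p n).2.1 (p n).2.2 (U (p n).1.2 0 (f n)).
have l0 n : 0 < (p n).1.1 by have [/andP[]] := pP n.
have uL n : inL2 (U (p n).1.2 0 (f n)).
  by have [h _ _ _] := hun (p n).1.2 0; exact: h.
have g_iso n :=
  tf_dilation_inv_norm_preserving (p n).2.1 (p n).2.2 (l0 n) (uL n).
have gL n : inL2 (g n) by have [] := g_iso n.
have gf n : L2norm (g n) = L2norm (f n).
  have [_ ->] := g_iso n.
  by have [_ _ h _] := hun (p n).1.2 0; exact: h.
have gB n : B <= normc (inner (g n) (@gaussian R d)).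
  rewrite normc_innerC// -(inner_tf_dilation (p n).2.1 (p n).2.2 (l0 n))//.
  by rewrite tf_dilation_invK//; have [] := pP n.
have [|s s_homo [phi phiL gphi]] := L2_weak_compact (A := A) gL.
  by move=> n; rewrite gf.
(* The lower bound [gB] passes to the weak limit, tested against the Gaussian. *)
have phi_low : B <= L2norm phi * M.
  have BI : B <= normc (inner phi (@gaussian R d)).
    apply/ler_addgt0Pr => e e0.
    have /cvgr0Pnorm_lt /(_ _ e0)[N _ /(_ N (leqnn N)) /= h] := gphi _ psiL.
    apply: le_trans (gB (s N)) _.
    have := le_normcD
      (inner (g (s N)) (@gaussian R d) - inner phi (@gaussian R d))
      (inner phi (@gaussian R d)).
    rewrite subrK addrC => /le_trans; apply.
    by rewrite lerD2l (le_trans (ler_norm _))// ltW.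
  apply: le_trans BI (le_trans (normc_inner_le phiL psiL) _).
  by rewrite ler_wpM2l ?L2norm_ge0// /M lerDr.
exists s; split=> //.
exists (fun n => (p (s n)).1.1), (fun n => (p (s n)).1.2),
  (fun n => (p (s n)).2.1), (fun n => (p (s n)).2.2), phi; split.
- by move=> n; have [h1 h2 _] := pP (s n); rewrite -ler_norml.
- split=> // phi0; have [zL z0] := @inL2_zero R d.
  by move: phi_low; rewrite (eqL2_L2norm phiL zL phi0) z0 mul0r leNgt B0.
- exact: gphi.
- rewrite (_ : k / M * _ * _ = B / M); first by rewrite ler_pdivrMr.
  by rewrite /B; ring.
move=> w.
(* All norms are transported to the frame of [g], where the profile is the
   fixed function [phi]. *)
have decomp n : L2norm (f (s n)) ^+ 2 - L2norm (fun y => f (s n) y - w n y) ^+ 2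
    - L2norm (w n) ^+ 2 =
    2 * complex.Re (inner (g (s n)) phi - inner phi phi).
  set q := p (s n); have q0 : 0 < q.1.1 by exact: l0.
  have hU1 : unitaryL2 (U q.1.2 0) by exact: hun.
  have tf_dilation_n := tf_dilation_norm_preserving q.2.1 q.2.2 q0.
  have [FL Fn] := tf_dilation_n _ phiL.
  have [wL wF] := inL2_invL2 hU1 FL.
  rewrite -/(w n) in wL wF.
  have -> : L2norm (w n) = L2norm phi.
    have [h1 _ h2 _] := hU1.
    by rewrite -(h2 _ wL) (eqL2_L2norm (h1 _ wL) FL wF).
  have -> : L2norm (fun y => f (s n) y - w n y) =
      L2norm (fun y => g (s n) y - phi y).
    rewrite (unitaryL2_L2normB hU1 (fL _) wL FL wF).
    have [_ <-] := tf_dilation_n _ (inL2_sub (gL (s n)) phiL).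
    apply: eq_L2norm => y; congr normc.
    rewrite -[U q.1.2 0 (f (s n))](tf_dilation_invK q.2.1 q.2.2 q0).
    by rewrite /tf_dilation /dilation /tf_shift !mulrBr.
  rewrite L2norm_sqB// gf -(inner_self phiL).
  by case: (inner (g (s n)) phi) (inner phi phi) => ? ? [? ?] /=; ring.
rewrite (_ : (fun n => _) = (fun n =>
    2 * complex.Re (inner (g (s n)) phi - inner phi phi))).
  rewrite -[X in _ --> X](mulr0 2); apply: cvgM; first exact: cvg_cst.
  apply: (@squeeze_cvgr _ _ _ _
    (fun n => - normc (inner (g (s n)) phi - inner phi phi))
    (fun n => normc (inner (g (s n)) phi - inner phi phi))).
  - by apply: nearW => n; rewrite -ler_norml normr_Re_le.
  - by rewrite -oppr0; apply: cvgN; exact: gphi.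
  - exact: gphi.
by apply/funext => n; exact: decomp.
Qed.
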